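(* Let $m, n \ge 1$ be integers, let $a > \tfrac12(m-1)$, and let $X_1, \ldots, X_n$ be independent random matrices, each with the Wishart distribution $W_m(a, I_m)$. Let $S_1 = X_1$, $S_{j+1} = S_j^{1/2} X_{j+1} S_j^{1/2}$ for $1 \le j \le n-1$, and $U_n = \max_{1 \le j \le n} d_R(I_m, S_j)$. Let $R_1, \ldots, R_n$ be i.i.d., $\chi^2_{(2a-m-1)m}$-distributed random variables. Then for every $t > 0$, $$\mathbb{P}(U_n \le t) \le \min_{1 \le j \le n} \mathbb{P}\Big( \prod_{i=1}^j R_i \le m^j \exp(m^{-1/2} t) \Big).$$ In particular, $$\mathbb{P}(U_n \le t) \le \mathbb{P}\big( \chi^2_{(2a-m-1)m} \le m \exp(m^{-1/2} t) \big).$$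
   Context: $\mathcal{P}_m$ is the cone of real symmetric positive definite $m \times m$ matrices, $I_m$ is the identity matrix, and $A^{1/2}$ is the positive definite square root of $A \in \mathcal{P}_m$. The Riemannian metric on $\mathcal{P}_m$ is $d_R(A,B) = \big(\sum_{j=1}^m [\log \lambda_j(A^{-1}B)]^2\big)^{1/2}$, where $\lambda_j(\cdot)$ denote eigenvalues. With $\Gamma_m(a) = \pi^{m(m-1)/4} \prod_{j=1}^m \Gamma(a - \tfrac12(j-1))$ for $a > \tfrac12(m-1)$, the Wishart distribution $W_m(a, I_m)$ is the distribution on $\mathcal{P}_m$ with density $$w(x) = \frac{1}{2^{ma} \Gamma_m(a)} (\det x)^{a - \frac12(m+1)} \exp(-\tfrac12 \operatorname{tr} x), \quad x \in \mathcal{P}_m,$$ with respect to Lebesgue measure $\prod_{1 \le i \le j \le m} dx_{ij}$. $\chi^2_\alpha$ denotes a random variable having the chi-squared distribution with $\alpha$ degrees of freedom. *)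

(* Defs.v *)
From HB Require Import structures.
From mathcomp Require Import all_boot all_order all_algebra.
From mathcomp Require Import all_classical all_reals all_analysis.

Set Implicit Arguments.
Unset Strict Implicit.
Unset Printing Implicit Defensive.

Import Order.TTheory GRing.Theory Num.Theory.
Import numFieldNormedType.Exports.

Local Open Scope classical_set_scope.
Local Open Scope ring_scope.

Section measurable_matrix.
Context {d : measure_display} {T : measurableType d}.
Variables m n : nat.

Definition mx_measurable : set (set 'M[T]_(m, n)) :=
  <<s \bigcup_(p in [set: 'I_m * 'I_n])
        preimage_set_system setT (fun A : 'M[T]_(m, n) => A p.1 p.2)
          measurable >>.

Let mx_measurable0 : mx_measurable set0.
Proof. exact: sigma_algebra0. Qed.

Let mx_measurableC A : mx_measurable A -> mx_measurable (~` A).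
Proof. exact: sigma_algebraC. Qed.

Let mx_measurable_bigcup (F : (set 'M[T]_(m, n))^nat) :
  (forall i, mx_measurable (F i)) -> mx_measurable (\bigcup_i (F i)).
Proof. exact: sigma_algebra_bigcup. Qed.

HB.instance Definition _ := @isMeasurable.Build (measure_tuple_display d)
  'M[T]_(m, n) mx_measurable mx_measurable0 mx_measurableC mx_measurable_bigcup.

Lemma measurable_mx_entry (i : 'I_m) (j : 'I_n) :
  measurable_fun setT (fun A : 'M[T]_(m, n) => A i j).
Proof.
move=> _ B mB; rewrite setTI; apply: sub_sigma_algebra.
by exists (i, j) => //; exists B => //; rewrite setTI.
Qed.

Lemma measurable_fun_mxP (d' : measure_display) (S : measurableType d')
    (f : S -> 'M[T]_(m, n)) :
  measurable_fun setT f <->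
  forall i j, measurable_fun setT (fun x => f x i j).
Proof.
split=> [mf i j|mf].
  exact: (measurableT_comp (measurable_mx_entry i j) mf).
move=> _ B mB; rewrite setTI.
suff : mx_measurable `<=` [set A : set 'M[T]_(m, n) | measurable (f @^-1` A)].
  by apply.
apply: smallest_sub.
  split => /=.
  - by rewrite preimage_set0.
  - by move=> A mA; rewrite setTD; exact: measurableC.
  - by move=> F mF; rewrite preimage_bigcup; exact: bigcup_measurable.
move=> _ [[i j] _ [C mC <-]] /=.
by have := mf i j measurableT C mC; rewrite !setTI.
Qed.

End measurable_matrix.

Section lebesgue_tuple.
Context {R : realType}.
Local Notation RR := (measurableTypeR R).

Definition cons_tuple k (x : RR * k.-tuple RR) : k.+1.-tuple RR :=
  [the k.+1.-tuple RR of x.1 :: x.2].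

Lemma measurable_cons_tuple k : measurable_fun setT (@cons_tuple k).
Proof. exact: (measurable_cons measurable_fst measurable_snd). Qed.

Section cons_measure.
Local Open Scope ereal_scope.
Variables (k : nat) (mu : {sigma_finite_measure set (k.-tuple RR) -> \bar R}).

Definition cons_measure : set (k.+1.-tuple RR) -> \bar R :=
  pushforward (@lebesgue_measure R \x mu) (@cons_tuple k).

Let cons_measure0 : cons_measure set0 = 0.
Proof. by rewrite /cons_measure /pushforward preimage_set0 measure0. Qed.

Let cons_measure_ge0 A : 0 <= cons_measure A.
Proof. by rewrite /cons_measure /pushforward; exact: measure_ge0. Qed.

Let cons_measure_sigma_additive : semi_sigma_additive cons_measure.
Proof.
move=> F mF tF mUF; rewrite /cons_measure /pushforward preimage_bigcup.
have mcons B : measurable B -> measurable (@cons_tuple k @^-1` B).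
  by move=> mB; rewrite -[X in measurable X]setTI; exact: measurable_cons_tuple.
apply: measure_semi_sigma_additive.
- by move=> n; exact: mcons.
- apply/trivIsetP => /= i j _ _ ij; rewrite -preimage_setI.
  by move/trivIsetP : tF => /(_ _ _ _ _ ij) ->//; rewrite preimage_set0.
- by rewrite -preimage_bigcup; exact: mcons.
Qed.

HB.instance Definition _ := isMeasure.Build _ _ _ cons_measure
  cons_measure0 cons_measure_ge0 cons_measure_sigma_additive.

Let cons_measure_sigma_finite : sigma_finite setT cons_measure.
Proof.
have [F FT Foo] : sigma_finite setT (@lebesgue_measure R \x mu).
  have /sigma_finiteP[A [TA ndA Aoo]] := sigma_finiteT (@lebesgue_measure R).
  have /sigma_finiteP[B [TB ndB Boo]] := sigma_finiteT mu.
  exists (fun n => A n `*` B n).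
    rewrite -setXTT TA TB predeqE => -[x y]; split.
      move=> [/= [n _ Anx] [l _ Bly]]; exists (maxn n l) => //; split.
      - by move: x Anx; exact/subsetPset/ndA/leq_maxl.
      - by move: y Bly; exact/subsetPset/ndB/leq_maxr.
    by move=> [n _ []/= ? ?]; split; exists n.
  move=> n; have [? ?] := Aoo n; have [? ?] := Boo n.
  split; first exact: measurableX.
  by rewrite product_measure1E// lte_mul_pinfty// ge0_fin_numE.
pose g (y : k.+1.-tuple RR) : RR * k.-tuple RR :=
  (thead y, [tuple of behead y]).
have mg : measurable_fun setT g.
  exact: (measurable_fun_pair (measurable_tnth _) (@measurable_behead _ _ _)).
have gK x : g (cons_tuple x) = x.
  by case: x => x y; congr pair; exact: val_inj.
exists (fun i => g @^-1` F i).
  by rewrite -preimage_bigcup -FT preimage_setT.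
move=> i; split.
  by rewrite -[X in measurable X]setTI; apply: mg => //; have [] := Foo i.
rewrite /cons_measure /pushforward -comp_preimage.
have -> : g \o @cons_tuple k = id by apply/funext => x; exact: gK.
by have [] := Foo i.
Qed.

HB.instance Definition _ := @Measure_isSigmaFinite.Build _ _ _
  cons_measure cons_measure_sigma_finite.

End cons_measure.

(* Lebesgue measure on R^k: the k-fold product of Lebesgue measure on R,
   transported along R * R^k = R^(k+1). *)
Fixpoint lebesgue_tuple k : {sigma_finite_measure set (k.-tuple RR) -> \bar R} :=
  match k with
  | 0 => [the {sigma_finite_measure set (0.-tuple RR) -> \bar R} of
           \d_([tuple] : 0.-tuple RR)]
  | k'.+1 => [the {sigma_finite_measure set (k'.+1.-tuple RR) -> \bar R} of
           cons_measure (lebesgue_tuple k')]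
  end.

End lebesgue_tuple.

Section laws.
Context {d d' : measure_display} {T : measurableType d}
  {T' : measurableType d'} {R : realType}.
Local Open Scope ereal_scope.

Definition has_law (P : probability T R) (X : {mfun T >-> T'})
    (nu : set T' -> \bar R) :=
  forall B, measurable B -> distribution P X B = nu B.

Definition mutually_independent (I : finType) (P : probability T R)
    (X : I -> {mfun T >-> T'}) :=
  forall (J : {set I}) (B : I -> set T'), (forall i, measurable (B i)) ->
    P (\bigcap_(i in [set` J]) (X i @^-1` B i)) =
    \prod_(i in J) P (X i @^-1` B i).

End laws.

Section gamma_functions.
Context {R : realType}.

Definition Gamma (a : R) : R :=
  (\int[lebesgue_measure]_(x in `]0%R, +oo[) (x `^ (a - 1) * expR (- x)))%R.

(* The index j is 0-based: the factors a - (j - 1) / 2 become a - j / 2. *)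
Definition mGamma (m : nat) (a : R) : R :=
  pi `^ ((m * m.-1)%:R / 4) * \prod_(j < m) Gamma (a - j%:R / 2).

End gamma_functions.

Section chi_squared.
Context {R : realType}.

Definition chi2_pdf (al x : R) : R :=
  x `^ (al / 2 - 1) * expR (- (x / 2)) / (2 `^ (al / 2) * Gamma (al / 2)).

Definition chi2_prob (al : R) (B : set R) : \bar R :=
  (\int[lebesgue_measure]_(x in B `&` `]0%R, +oo[) (chi2_pdf al x)%:E)%E.

(* There is no chi-squared law with al <= 0 degrees of freedom: Gamma (al / 2)
   is a divergent integral, so that chi2_prob al is not a probability. *)
Definition chi2_distributed (d : measure_display) (T : measurableType d)
    (P : probability T R) (al : R) (X : {mfun T >-> R}) :=
  0 < al /\ has_law P X (chi2_prob al).

End chi_squared.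

Section posdef.
Context {R : realType} {m : nat}.
Implicit Types A B : 'M[R]_m.

Definition posdefmx : set 'M[R]_m :=
  [set A | A^T = A /\ forall u : 'rV[R]_m, u != 0 -> 0 < (u *m A *m u^T) 0 0].

Definition posdef_sqrt A : 'M[R]_m :=
  xget 0 [set B | posdefmx B /\ B *m B = A].

(* The list of eigenvalues of A with multiplicity, when the characteristic
   polynomial splits over R (which it does for A = P^-1 Q with P, Q positive
   definite); the order is unspecified. *)
Definition eigenvalues A : seq R :=
  xget [::] [set s | char_poly A = \prod_(x <- s) ('X - x%:P)].

Definition riem_dist A B : R :=
  Num.sqrt (\sum_(x <- eigenvalues (invmx A *m B)) ln x ^+ 2).

End posdef.

Section wishart.
Context {R : realType} (m : nat).

Definition upper_index : pred ('I_m * 'I_m) :=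
  fun p => (p.1 <= p.2)%N.

(* The symmetric matrix whose entries x_ij, i <= j, listed in the order of
   enum upper_index, are the coordinates of v; integrating over v against
   lebesgue_tuple is integrating against prod_(i <= j) dx_ij. *)
Definition sym_mx (v : #|upper_index|.-tuple R) : 'M[R]_m :=
  \matrix_(i, j) nth 0 v
    (index (if (i <= j)%N then (i, j) else (j, i)) (enum upper_index)).

Definition wishart_pdf (a : R) (x : 'M[R]_m) : R :=
  \det x `^ (a - m.+1%:R / 2) * expR (- (\tr x / 2)) /
  (2 `^ (m%:R * a) * mGamma m a).

Definition wishart_prob (a : R) (B : set 'M[R]_m) : \bar R :=
  (\int[lebesgue_tuple #|upper_index|]_(v in sym_mx @^-1` (B `&` posdefmx))
     (wishart_pdf a (sym_mx v))%:E)%E.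

End wishart.

Section random_walk.
Context {R : realType} {m : nat}.

(* With x 0, x 1, ... standing for X_1, X_2, ..., posdef_walk x j is S_(j+1). *)
Fixpoint posdef_walk (x : nat -> 'M[R]_m) (j : nat) : 'M[R]_m :=
  match j with
  | 0 => x 0%N
  | j'.+1 => let r := posdef_sqrt (posdef_walk x j') in r *m x j *m r
  end.

(* riem_dist is nonnegative, so the base value 0 is immaterial for n >= 1. *)
Definition max_dist (x : nat -> 'M[R]_m) (n : nat) : R :=
  \big[Num.max/0]_(j < n) riem_dist 1%:M (posdef_walk x j).

End random_walk.

(* Main.v *)
(* By Cauchy-Schwarz, d_R(I, S) is at least m^(-1/2) log det S, and det S_j is
   the product of the det X_i, so it suffices to show that log det X dominates
   m log (R / m) stochastically; independence carries this over to sums.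
   Taking Schur complements of the first entry, det X is distributed as a
   product of independent variables x_1 ... x_m, with x_(k+1) of density
   proportional to x^(p + k/2) e^(-x/2), where p = a - (m+1)/2.  By induction
   on k one compares x_1 ... x_k with (G_k / k)^k, where G_k is chi-squared
   with 2kp degrees of freedom: the ratio of the density of
   log (x_(k+1) (G_k / k)^k) to that of log (G_(k+1) / (k+1))^(k+1) is
   nondecreasing, because q |-> q^(-1/k) is convex.  Normalizing constants are
   never computed: total masses are 1 because the laws are probabilities. *)

Require Import Defs.
From HB Require Import structures.
From mathcomp Require Import all_boot all_order all_algebra.
From mathcomp Require Import all_classical all_reals all_analysis.
From mathcomp Require Import measurable_realfun complex spectral ring lra.

Set Implicit Arguments.
Unset Strict Implicit.
Unset Printing Implicit Defensive.

Import Order.TTheory GRing.Theory Num.Theory.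
Import numFieldNormedType.Exports.

Local Open Scope classical_set_scope.
Local Open Scope ring_scope.

(** * Diagonalization of symmetric matrices and the walk *)

(** The induction closes because the logarithm of [(G_k / k)^k] has density proportional to
    [expR (p * u - k / 2 * expR (u / k))]. The slope [p] is the same for every [k], and taking Schur
    complements preserves the same [p]. It therefore cancels from the likelihood ratio between
    stages [k] and [k + 1], which involves [k] alone. At [k = m] the degrees of freedom [2 * m * p]
    are those of the theorem, and their positivity is [0 < p]. A monotone likelihood ratio yields
    stochastic order through Chebyshev's association inequality. Every comparison is a
    cross-multiplied inequality between unnormalized integrals in the extended reals. Cancelling a
    mass needs it positive and finite. Finiteness is known at [k = m] only, and an AM-GM bound
    carries it down to smaller [k]. A separate obstacle is that the square root and the list of
    eigenvalues are obtained by choice. Both must be identified through a diagonalization before any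
    determinant, distance or measurability statement about the walk is accessible. *)

Lemma symmetric_diagonalizable (R : rcfType) (m : nat) (A : 'M[R]_m) :
  A^T = A -> exists P (d : 'rV[R]_m),
    P \in unitmx /\ A = invmx P *m diag_mx d *m P.
Proof.
move=> symA.
(* The complexified matrix is Hermitian, hence diagonalizable with real eigenvalues, and real
   matrices similar over [R[i]] are similar over [R]. Only similarity is retained: nothing says that
   [P] is orthogonal. *)
pose f : {rmorphism R -> R[i]} := complex.real_complex R.
have real_f x : f x \is Num.real by apply/complex.complex_realP; exists x.
have realf n k (B : 'M[R]_(n, k)) : map_mx f B \is a mxOver Num.real.
  by apply/mxOverP => i j; rewrite mxE.
have realE n k (B : 'M[complex.complex R]_(n, k)) : B \is a mxOver Num.real ->
    exists C, B = map_mx f C.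
  move=> /mxOverP rB; exists (map_mx (@complex.Re R) B).
  by apply/matrixP => i j; rewrite !mxE; exact/esym/complex.RRe_real/rB.
have sfA : map_mx f A \is hermsymmx.
  apply: realsym_hermsym => //.
  by apply/is_hermitianmxP; rewrite expr0 scale1r map_mx_id// map_trmx symA.
have [d dE] := realE _ _ _ (hermitian_spectral_diag_real sfA).
have /orthomx_spectralP AE := hermitian_normalmx sfA.
have sim : similar_in unitmx (map_mx f A) (diag_mx (map_mx f d)).
  exists (spectralmx (map_mx f A)); first exact: spectral_unit.
  apply/similarP; first exact: spectral_unit.
  by rewrite -dE {2}AE !mulmxA mulmxV ?spectral_unit// mul1mx.
rewrite -map_diag_mx in sim.
have [//|Q /andP[Qr Qu] /(similarP Qu) QA] := real_similar sim (realf _ _ _).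
have [P PE] := realE _ _ _ Qr; exists P, d.
move: Qu QA; rewrite PE map_unitmx => Pu; rewrite -!map_mxM => /map_mx_inj PA.
split=> //.
by rewrite -mulmxA -PA// mulKmx.
Qed.

(** Newton interpolation: a new node is matched by adding a multiple of the polynomial that vanishes
    at the old ones. A function applied to eigenvalues thereby becomes a polynomial in the
    matrix. *)
Lemma exists_interpolant (F : fieldType) (f : F -> F) (s : seq F) :
  exists p : {poly F}, {in s, forall x, p.[x] = f x}.
Proof.
elim: s => [|x s [p pf]]; first by exists 0.
have [xs|xs] := boolP (x \in s).
  by exists p => y; rewrite inE => /predU1P[->|/pf//]; exact: pf.
pose q := \prod_(y <- s) ('X - y%:P).
have qx : q.[x] != 0.
  by apply: contra xs; rewrite -rootE root_prod_XsubC.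
exists (p + ((f x - p.[x]) / q.[x])%:P * q) => y.
rewrite inE => /predU1P[->|ys]; rewrite !hornerE.
  by rewrite divfK// addrC subrK.
by have /eqP -> : q.[y] == 0; rewrite ?mulr0 ?addr0 ?pf// -rootE root_prod_XsubC.
Qed.

Section diagonalized_matrices.
Variables (F : fieldType) (m : nat).
Implicit Types (P : 'M[F]_m) (d e : 'rV[F]_m).

Lemma conj_diagM P d e : P \in unitmx ->
  (invmx P *m diag_mx d *m P) *m (invmx P *m diag_mx e *m P) =
  invmx P *m diag_mx (\row_i (d 0 i * e 0 i)) *m P.
Proof.
move=> Pu; rewrite !mulmxA mulmxK// -[X in X *m P = _]mulmxA mulmx_diag.
by congr (_ *m diag_mx _ *m _); apply/rowP => i; rewrite !mxE.
Qed.

Lemma det_conj_diag P d : P \in unitmx ->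
  \det (invmx P *m diag_mx d *m P) = \prod_i d 0 i.
Proof.
move=> Pu; rewrite !det_mulmx mulrAC -det_mulmx mulVmx// det1 mul1r.
by rewrite det_diag.
Qed.

Lemma tr_conj_diag P d : P \in unitmx ->
  \tr (invmx P *m diag_mx d *m P) = \sum_i d 0 i.
Proof. by move=> Pu; rewrite mxtrace_mulC mulKVmx// mxtrace_diag. Qed.

Lemma char_poly_conj_diag P d : P \in unitmx ->
  char_poly (invmx P *m diag_mx d *m P) = \prod_i ('X - (d 0 i)%:P).
Proof.
move=> Pu; rewrite /char_poly /char_poly_mx.
have -> : 'X%:M - map_mx polyC (invmx P *m diag_mx d *m P) =
    invmx (map_mx polyC P) *m ('X%:M - map_mx polyC (diag_mx d)) *m
    map_mx polyC P.
  rewrite mulmxBr mulmxBl scalar_mxC.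
  have Pu' : map_mx polyC P \in unitmx.
    by rewrite unitmxE det_map_mx rmorph_unit// -unitmxE.
  rewrite -[X in _ = X - _]mulmxA mulVmx// mulmx1; congr (_ - _).
  rewrite !map_mxM; congr (_ *m _ *m _).
  by rewrite -[LHS](mulmxK Pu') -map_mxM mulVmx// map_mx1 mul1mx.
have Pu' : map_mx polyC P \in unitmx.
  by rewrite unitmxE det_map_mx rmorph_unit// -unitmxE.
rewrite !det_mulmx mulrAC -det_mulmx mulVmx// det1 mul1r.
rewrite map_diag_mx -diag_const_mx -linearB/= det_diag.
by apply: eq_bigr => i _; rewrite !mxE.
Qed.

End diagonalized_matrices.

Section functional_calculus.
Variables (F : fieldType) (m : nat).
Implicit Types (A P Q : 'M[F]_m.+1) (d e : 'rV[F]_m.+1).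

Lemma horner_mx_conj_diag p P d : P \in unitmx ->
  horner_mx (invmx P *m diag_mx d *m P) p =
  invmx P *m diag_mx (map_mx (horner p) d) *m P.
Proof. by move=> Pu; rewrite mxpoly.horner_mx_uconjC// horner_mx_diag. Qed.

(** The list [s] leaves room for a second spectrum, so that one polynomial can serve two
    diagonalizations at once. *)
Lemma conj_diag_mapE (f : F -> F) (s : seq F) P d : P \in unitmx ->
  exists p : {poly F}, {in s, forall x, p.[x] = f x} /\
  invmx P *m diag_mx (map_mx f d) *m P =
  horner_mx (invmx P *m diag_mx d *m P) p.
Proof.
move=> Pu; have [p pf] := exists_interpolant f (s ++ [seq d 0 i | i : 'I_m.+1]).
exists p; split; first by move=> x xs; apply: pf; rewrite mem_cat xs.
rewrite horner_mx_conj_diag//; congr (_ *m diag_mx _ *m _).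
apply/rowP => i; rewrite !mxE pf// mem_cat; apply/orP; right.
by apply/mapP; exists i => //; rewrite mem_enum.
Qed.

(** Both sides are one polynomial evaluated at one matrix, so functional calculus does not depend on
    the diagonalization. *)
Lemma conj_diag_map_unique (f : F -> F) P Q d e :
  P \in unitmx -> Q \in unitmx ->
  invmx P *m diag_mx d *m P = invmx Q *m diag_mx e *m Q ->
  invmx P *m diag_mx (map_mx f d) *m P = invmx Q *m diag_mx (map_mx f e) *m Q.
Proof.
move=> Pu Qu PQ.
have [p [pf ->]] := conj_diag_mapE f [seq e 0 i | i : 'I_m.+1] d Pu.
rewrite PQ horner_mx_conj_diag//; congr (_ *m diag_mx _ *m _).
by apply/rowP => i; rewrite !mxE pf//; apply/mapP; exists i; rewrite ?mem_enum.
Qed.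

Lemma trmx_horner_mx A p : (horner_mx A p)^T = horner_mx A^T p.
Proof.
elim/poly_ind: p => [|p c IH]; first by rewrite !rmorph0 trmx0.
rewrite !rmorphD !rmorphM /= !horner_mx_X !horner_mx_C linearD /= tr_scalar_mx.
congr (_ + _); rewrite -[LHS]/((_ *m _)^T) trmx_mul IH.
exact/esym/comm_horner_mx.
Qed.

(** As [P] is not known to be orthogonal, symmetry cannot be read off the formula; it is inherited
    from [A] because the result is a polynomial in [A]. *)
Lemma conj_diag_map_sym (f : F -> F) P d (A := invmx P *m diag_mx d *m P) :
  P \in unitmx -> A^T = A ->
  (invmx P *m diag_mx (map_mx f d) *m P)^T =
  invmx P *m diag_mx (map_mx f d) *m P.
Proof.
move=> Pu As; have [p [_ ->]] := conj_diag_mapE f [::] d Pu.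
by rewrite trmx_horner_mx As.
Qed.

End functional_calculus.

Lemma sqr_norm_gt0 (R : realType) n (u : 'rV[R]_n) : u != 0 -> 0 < (u *m u^T) 0 0.
Proof.
move=> u0; rewrite mxE lt_neqAle eq_sym andbC sumr_ge0 /=; last first.
  by move=> i _; rewrite mxE -expr2 sqr_ge0.
apply: contra u0 => /eqP; under eq_bigr do rewrite mxE -expr2.
move=> /psumr_eq0P u0; apply/eqP/rowP => i; rewrite mxE.
by apply/eqP; rewrite -sqrf_eq0 u0// => j _; exact: sqr_ge0.
Qed.

Lemma posdef_congruence (R : realType) m (A B : 'M[R]_m) : posdefmx A -> B \in unitmx ->
  posdefmx (B *m A *m B^T).
Proof.
move=> [As Ap] Bu; split; first by rewrite !trmx_mul trmxK As mulmxA.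
move=> u u0; rewrite !mulmxA -mulmxA -trmx_mul; apply: Ap.
by apply: contra_neq u0 => /(congr1 (mulmx^~ (invmx B))); rewrite mulmxK// mul0mx.
Qed.

(** * Positive definite matrices and their square roots *)

Section positive_definite.
Context {R : realType} {m : nat}.
Implicit Types (A P : 'M[R]_m) (d : 'rV[R]_m).

(** The rows of [P] are left eigenvectors of [A]: at [row i P] the quadratic form equals [d 0 i]
    times a squared norm. *)
Lemma posdef_conj_diag_gt0 A P d : posdefmx A -> P \in unitmx ->
  A = invmx P *m diag_mx d *m P -> forall i, 0 < d 0 i.
Proof.
move=> [_ Apos] Pu AE i.
have r0 : row i P != 0.
  apply/eqP => /(congr1 (mulmx^~ (invmx P))).
  rewrite -row_mul mulmxV// mul0mx => /rowP/(_ i).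
  by rewrite !mxE eqxx => /eqP; rewrite oner_eq0.
have := Apos _ r0; have -> : row i P *m A = d 0 i *: row i P.
  by rewrite -row_mul AE !mulmxA mulmxV// mul1mx row_mul row_diag_mx -scalemxAl -rowE.
by rewrite -scalemxAl mxE pmulr_lgt0//; exact: sqr_norm_gt0.
Qed.

Lemma posdef_diagonalizable A : posdefmx A -> exists P d,
  [/\ P \in unitmx, A = invmx P *m diag_mx d *m P & forall i, 0 < d 0 i].
Proof.
move=> Apd; have [P [d [Pu AE]]] := symmetric_diagonalizable Apd.1.
by exists P, d; split=> //; exact: posdef_conj_diag_gt0 AE.
Qed.

Lemma posdef_det_gt0 A : posdefmx A -> 0 < \det A.
Proof.
move=> /posdef_diagonalizable[P [d [Pu -> d0]]].
by rewrite det_conj_diag// prodr_gt0.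
Qed.

Lemma posdef_unitmx A : posdefmx A -> A \in unitmx.
Proof. by move=> /posdef_det_gt0 A0; rewrite unitmxE unitfE gt_eqF. Qed.

End positive_definite.

Section posdef_square_root.
Context {R : realType} {m : nat}.
Implicit Types (A B X P Q : 'M[R]_m.+1) (d e : 'rV[R]_m.+1).

Lemma posdef1 : posdefmx (1%:M : 'M[R]_m.+1).
Proof. by split=> [|u u0]; rewrite ?trmx1// mulmx1 sqr_norm_gt0. Qed.

Lemma posdef_conj_diag_map (f : R -> R) A P d : posdefmx A -> P \in unitmx ->
  A = invmx P *m diag_mx d *m P -> (forall x, 0 < x -> 0 < f x) ->
  posdefmx (invmx P *m diag_mx (map_mx f d) *m P).
Proof.
move=> Apd Pu AE f0; have d0 := posdef_conj_diag_gt0 Apd Pu AE.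
(* A symmetric square root of the matrix in question, which exhibits it as congruent to the
   identity. *)
pose B := invmx P *m diag_mx (map_mx (Num.sqrt \o f) d) *m P.
have Bs : B^T = B by apply: conj_diag_map_sym => //; rewrite -AE; exact: Apd.1.
have -> : invmx P *m diag_mx (map_mx f d) *m P = B *m 1%:M *m B^T.
  rewrite mulmx1 Bs /B conj_diagM//; congr (_ *m diag_mx _ *m _).
  by apply/rowP => i; rewrite !mxE/= -expr2 sqr_sqrtr// ltW// f0.
apply: posdef_congruence; first exact: posdef1.
rewrite unitmxE unitfE gt_eqF// det_conj_diag// prodr_gt0// => i _.
by rewrite mxE/= sqrtr_gt0 f0.
Qed.

(** Since [posdef_sqrt] is a choice, uniqueness is the point: a positive definite [B] with
    [B *m B = A] has positive eigenvalues, so it is itself [Num.sqrt] applied to [B *m B], and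
    functional calculus is independent of the diagonalization. *)
Lemma posdef_sqrtE A P d : posdefmx A -> P \in unitmx ->
  A = invmx P *m diag_mx d *m P ->
  posdef_sqrt A = invmx P *m diag_mx (map_mx Num.sqrt d) *m P.
Proof.
move=> Apd Pu AE; have d0 := posdef_conj_diag_gt0 Apd Pu AE.
rewrite /posdef_sqrt; case: xgetP => [B _ [Bpd BA]|/(_ _) nex]; last first.
  exfalso; apply: (nex (invmx P *m diag_mx (map_mx Num.sqrt d) *m P)); split.
    by apply: (posdef_conj_diag_map Apd Pu AE) => // x x0; rewrite sqrtr_gt0.
  rewrite conj_diagM// AE; congr (_ *m diag_mx _ *m _).
  by apply/rowP => i; rewrite !mxE -expr2 sqr_sqrtr// ltW.
have [Q [e [Qu BE e0]]] := posdef_diagonalizable Bpd.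
rewrite (@conj_diag_map_unique _ _ _ P Q d (\row_i (e 0 i * e 0 i)))//.
  rewrite {1}BE; congr (_ *m diag_mx _ *m _); apply/rowP => i.
  by rewrite !mxE -expr2 sqrtr_sqr gtr0_norm.
by rewrite -AE -BA BE conj_diagM.
Qed.

Lemma posdef_sqrtP A : posdefmx A ->
  posdefmx (posdef_sqrt A) /\ posdef_sqrt A *m posdef_sqrt A = A.
Proof.
move=> Apd; have [P [d [Pu AE d0]]] := posdef_diagonalizable Apd.
rewrite (posdef_sqrtE Apd Pu AE); split.
  by apply: (posdef_conj_diag_map Apd Pu AE) => // x x0; rewrite sqrtr_gt0.
rewrite conj_diagM// [RHS]AE; congr (_ *m diag_mx _ *m _).
by apply/rowP => i; rewrite !mxE -expr2 sqr_sqrtr// ltW.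
Qed.

Lemma posdef_sqrt_conj A X : posdefmx A -> posdefmx X ->
  posdefmx (posdef_sqrt A *m X *m posdef_sqrt A).
Proof.
move=> /posdef_sqrtP[sA _] Xpd.
have := posdef_congruence Xpd (posdef_unitmx sA).
by rewrite sA.1.
Qed.

Lemma det_posdef_sqrt_conj A X : posdefmx A ->
  \det (posdef_sqrt A *m X *m posdef_sqrt A) = \det A * \det X.
Proof.
move=> /posdef_sqrtP[_ sA].
by rewrite !det_mulmx mulrAC -det_mulmx sA.
Qed.

Lemma posdef_walk_posdef (x : nat -> 'M[R]_m.+1) (j : nat) :
  (forall i, (i <= j)%N -> posdefmx (x i)) -> posdefmx (posdef_walk x j).
Proof.
elim: j => [|j IH] xpd; first exact: xpd.
apply: posdef_sqrt_conj; last exact: xpd.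
by apply: IH => i ij; apply: xpd; rewrite leqW.
Qed.

Lemma det_posdef_walk (x : nat -> 'M[R]_m.+1) (j : nat) :
  (forall i, (i <= j)%N -> posdefmx (x i)) ->
  \det (posdef_walk x j) = \prod_(i < j.+1) \det (x i).
Proof.
elim: j => [|j IH] xpd; first by rewrite big_ord_recr big_ord0 /= mul1r.
rewrite big_ord_recr /= -IH; last by move=> i ij; apply: xpd; rewrite leqW.
rewrite det_posdef_sqrt_conj//; apply: posdef_walk_posdef => i ij.
by apply: xpd; rewrite leqW.
Qed.

(** Whichever list [eigenvalues] picks, unique factorization of the characteristic polynomial fixes
    it up to order, and the sum is symmetric. *)
Lemma riem_dist1E A P d : P \in unitmx -> A = invmx P *m diag_mx d *m P ->
  riem_dist 1%:M A = Num.sqrt (\sum_i ln (d 0 i) ^+ 2).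
Proof.
move=> Pu AE; rewrite /riem_dist invmx1 mul1mx; congr Num.sqrt.
have dE : char_poly A =
    \prod_(x <- [seq d 0 i | i <- enum 'I_m.+1]) ('X - x%:P).
  by rewrite AE char_poly_conj_diag// big_map big_enum.
rewrite /eigenvalues; case: xgetP => [s _ /= sE|/(_ _) nex]; last first.
  by exfalso; exact: (nex _ dE).
have : perm_eq s [seq d 0 i | i <- enum 'I_m.+1].
  by apply: prod_XsubC_eq; rewrite -sE.
by move=> /(perm_big _) ->; rewrite big_map big_enum.
Qed.

Lemma ln_det_le_riem_dist A : posdefmx A ->
  ln (\det A) <= Num.sqrt m.+1%:R * riem_dist 1%:M A.
Proof.
move=> /posdef_diagonalizable[P [d [Pu AE d0]]].
rewrite (riem_dist1E Pu AE) -sqrtrM//.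
have -> : ln (\det A) = \sum_i ln (d 0 i).
  rewrite AE det_conj_diag//.
  have : forall i, i \in enum 'I_m.+1 -> 0 < d 0 i by [].
  rewrite -[in LHS]big_enum -[in RHS]big_enum /=.
  elim: (enum _) => [|i s IH] s0; first by rewrite !big_nil ln1.
  by rewrite !big_cons lnM ?posrE ?prodr_gt0// IH.
apply: le_trans (ler_norm _) _; rewrite -sqrtr_sqr ler_wsqrtr//.
set S := \sum_i _.
pose M : R := m.+1%:R.
have M0 : 0 < M by rewrite ltr0n.
(* Cauchy-Schwarz as nonnegativity of a variance: this sum is [M] times the gap between
   [M * \sum_i ln (d 0 i) ^+ 2] and [S ^+ 2]. *)
have : 0 <= \sum_i (M * ln (d 0 i) - S) ^+ 2 by apply: sumr_ge0 => i _; exact: sqr_ge0.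
have -> : \sum_i (M * ln (d 0 i) - S) ^+ 2 =
    M ^+ 2 * (\sum_i ln (d 0 i) ^+ 2) - M * S ^+ 2.
  transitivity (\sum_i (M ^+ 2 * ln (d 0 i) ^+ 2 - (2 * M * S) * ln (d 0 i) + S ^+ 2)).
    by apply: eq_bigr => i _; ring.
  rewrite big_split sumrB /= -!mulr_sumr sumr_const card_ord -/S -mulr_natl -/M.
  ring.
have -> : M ^+ 2 * (\sum_i ln (d 0 i) ^+ 2) - M * S ^+ 2 =
  M * (M * (\sum_i ln (d 0 i) ^+ 2) - S ^+ 2) by ring.
by rewrite pmulr_rge0// subr_ge0.
Qed.

End posdef_square_root.

(** * Measurability of the distance *)

Section measurable_matrix_operations.
Context {d : measure_display} {T : measurableType d} {R : realType}.

(* [x * expR (- ln (x ^+ 2))] is [x^-1], also at [x = 0]. *)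
Lemma measurable_invr : measurable_fun setT (fun x : R => x^-1).
Proof.
have -> : (fun x : R => x^-1) = (fun x => x * expR (- ln (x ^+ 2))).
  apply/funext => x; have [->|x0] := eqVneq x 0; first by rewrite invr0 mul0r.
  rewrite expRN lnK ?posrE ?exprn_even_gt0//.
  by rewrite expr2 invfM mulrA divff// mul1r.
apply: measurable_funM => //; apply: measurableT_comp => //.
apply: measurable_funN; apply: measurableT_comp => //. 
Qed.

Lemma measurable_fun_mulmx m n k (f : T -> 'M[R]_(m, n)) (g : T -> 'M[R]_(n, k)) :
  measurable_fun setT f -> measurable_fun setT g ->
  measurable_fun setT (fun t => f t *m g t).
Proof.
move=> /measurable_fun_mxP mf /measurable_fun_mxP mg.
apply/measurable_fun_mxP => i j.
under eq_fun do rewrite mxE.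
by apply: measurable_sum => l; apply: measurable_funM.
Qed.

Lemma measurable_fun_addmx m n (f g : T -> 'M[R]_(m, n)) :
  measurable_fun setT f -> measurable_fun setT g ->
  measurable_fun setT (fun t => f t + g t).
Proof.
move=> /measurable_fun_mxP mf /measurable_fun_mxP mg.
apply/measurable_fun_mxP => i j.
under eq_fun do rewrite mxE.
exact: measurable_funD.
Qed.

Lemma measurable_fun_scalemx m n (f : T -> R) (g : T -> 'M[R]_(m, n)) :
  measurable_fun setT f -> measurable_fun setT g ->
  measurable_fun setT (fun t => f t *: g t).
Proof.
move=> mf /measurable_fun_mxP mg.
apply/measurable_fun_mxP => i j.
under eq_fun do rewrite mxE.
exact: measurable_funM.
Qed.

Lemma measurable_fun_det m (f : T -> 'M[R]_m) :
  measurable_fun setT f -> measurable_fun setT (fun t => \det (f t)).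
Proof.
move=> /measurable_fun_mxP mf; apply: measurable_sum => s.
by apply: measurable_funM => //; apply: measurable_prod => i _.
Qed.

Lemma measurable_fun_mxtrace m (f : T -> 'M[R]_m) :
  measurable_fun setT f -> measurable_fun setT (fun t => \tr (f t)).
Proof. by move=> /measurable_fun_mxP mf; apply: measurable_sum. Qed.

Lemma measurable_fun_invmx m (f : T -> 'M[R]_m) : (forall t, f t \in unitmx) ->
  measurable_fun setT f -> measurable_fun setT (fun t => invmx (f t)).
Proof.
move=> fu mf.
have -> : (fun t => invmx (f t)) = (fun t => (\det (f t))^-1 *: \adj (f t)).
  by apply/funext => t; rewrite /invmx fu.
apply: measurable_fun_scalemx.
  apply: (measurableT_comp measurable_invr); exact: measurable_fun_det.
apply/measurable_fun_mxP => i j.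
under eq_fun do rewrite mxE.
apply: measurable_funM => //; apply: measurable_fun_det.
apply/measurable_fun_mxP => k l.
under eq_fun do rewrite !mxE.
by move/measurable_fun_mxP : mf; exact.
Qed.

Lemma measurable_fun_mx_cvg m n (h : nat -> T -> 'M[R]_(m, n))
    (f : T -> 'M[R]_(m, n)) :
  (forall k, measurable_fun setT (h k)) ->
  (forall t i j, h k t i j @[k --> \oo] --> f t i j) ->
  measurable_fun setT f.
Proof.
move=> mh hf; apply/measurable_fun_mxP => i j.
apply: (@measurable_fun_cvg _ _ _ _ (fun k t => h k t i j)) => [k|t _].
  by move/measurable_fun_mxP : (mh k).
exact: hf.
Qed.

End measurable_matrix_operations.

(* The square root, hence the walk, and the logarithms in the distance are
   limits of sequences of matrices built with ring operations, inverses and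
   square roots; this makes the event [U_n <= t] measurable. *)
Section newton.
Context {R : realType}.

Definition newton_sqrt (x : R) (k : nat) : R :=
  iter k (fun y => 2^-1 * (y + x * y^-1)) 1.

Lemma newton_sqrt_gt0 x k : 0 < x -> 0 < newton_sqrt x k.
Proof.
move=> x0; elim: k => [|k IH] //=.
by rewrite mulr_gt0// addr_gt0// mulr_gt0// invr_gt0.
Qed.

Lemma newton_sqrtS_err x k : 0 < x ->
  newton_sqrt x k.+1 - Num.sqrt x =
  (newton_sqrt x k - Num.sqrt x) ^+ 2 / (2 * newton_sqrt x k).
Proof.
move=> x0; have y0 := newton_sqrt_gt0 k x0; rewrite /= -/(newton_sqrt x k).
rewrite -[X in X * _^-1](sqr_sqrtr (ltW x0)); field.
by rewrite gt_eqF.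
Qed.

Lemma cvg_newton_sqrt x : 0 < x -> newton_sqrt x k @[k --> \oo] --> Num.sqrt x.
Proof.
(* The starting value 1 may lie below the root. From the first step on the iterates are above it, so
   the error is at most the iterate and the quadratic error formula at least halves it. *)
move=> x0; rewrite -cvg_shiftS /=.
pose e k := newton_sqrt x k.+1 - Num.sqrt x.
have e0 k : 0 <= e k.
  rewrite /e newton_sqrtS_err// divr_ge0 ?sqr_ge0// mulr_ge0// ltW//.
  exact: newton_sqrt_gt0.
have e2 k : e k.+1 <= 2^-1 * e k.
  rewrite /e newton_sqrtS_err// -/(e k) invfM mulrCA expr2 -mulrA.
  rewrite ler_wpM2l// ?invr_ge0// ler_piMr ?e0//.
  rewrite ler_pdivrMr ?newton_sqrt_gt0// mul1r /e gerBl.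
  exact: sqrtr_ge0.
have eg k : e k <= geometric (e 0) 2^-1 k.
  elim: k => [|k IH]; first by rewrite /geometric/= expr0 mulr1.
  apply: le_trans (e2 k) _; rewrite /geometric/= exprS mulrCA.
  by rewrite ler_wpM2l// invr_ge0.
have : e k @[k --> \oo] --> (0 : R).
  apply: (@squeeze_cvgr _ _ _ _ (cst 0) (geometric (e 0) 2^-1)).
  - by near=> k; rewrite /cst e0 eg.
  - exact: cvg_cst.
  - apply: cvg_geometric; by rewrite ger0_norm ?invr_ge0// invf_lt1// ltr1n.
move=> /(cvgD (cvg_cst (Num.sqrt x))); rewrite addr0.
by apply: cvg_trans; apply: near_eq_cvg; near=> k; rewrite /e/= addrC subrK.
Unshelve. all: by end_near. Qed.

Definition newton_sqrtmx m (A : 'M[R]_m) (k : nat) : 'M[R]_m :=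
  iter k (fun B => 2^-1 *: (B + A *m invmx B)) 1%:M.

Lemma newton_sqrtmxE m (P : 'M[R]_m.+1) (e : 'rV[R]_m.+1) k : P \in unitmx ->
  (forall i, 0 < e 0 i) ->
  newton_sqrtmx (invmx P *m diag_mx e *m P) k =
  invmx P *m diag_mx (map_mx (newton_sqrt^~ k) e) *m P.
Proof.
move=> Pu e0; elim: k => [|k IH].
  rewrite /= (_ : map_mx _ _ = const_mx 1) ?diag_const_mx ?mulmx1 ?mulVmx//.
  by apply/rowP => i; rewrite !mxE.
rewrite [LHS]/= -/(newton_sqrtmx _ k) IH.
have inv : invmx (invmx P *m diag_mx (map_mx (newton_sqrt^~ k) e) *m P) =
    invmx P *m diag_mx (map_mx (fun x => (newton_sqrt x k)^-1) e) *m P.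
  set B := (X in invmx X); set C := RHS.
  have BC : B *m C = 1%:M.
    rewrite conj_diagM// (_ : \row_i _ = const_mx 1).
      by rewrite diag_const_mx mulmx1 mulVmx.
    by apply/rowP => i; rewrite !mxE divff// gt_eqF// newton_sqrt_gt0.
  by have [Bu _] := mulmx1_unit BC; rewrite -[LHS]mulmx1 -BC mulKmx.
rewrite inv conj_diagM// -mulmxDl -mulmxDr scalemxAl scalemxAr.
congr (_ *m _ *m _); rewrite -linearD -linearZ /=; congr diag_mx.
by apply/rowP => i; rewrite !mxE.
Qed.

End newton.

Section measurable_riem_dist.
Context {d : measure_display} {T : measurableType d} {R : realType} {m : nat}.
Implicit Types A : T -> 'M[R]_m.+1.

Lemma cvg_conj_diag (P : 'M[R]_m.+1) (h : nat -> 'rV[R]_m.+1)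
    (e : 'rV[R]_m.+1) i j :
  (forall l, h k 0 l @[k --> \oo] --> e 0 l) ->
  (invmx P *m diag_mx (h k) *m P) i j @[k --> \oo] -->
  (invmx P *m diag_mx e *m P) i j.
Proof.
move=> he.
have E (v : 'rV[R]_m.+1) : (invmx P *m diag_mx v *m P) i j =
    \sum_l invmx P i l * P l j * v 0 l.
  rewrite mxE; apply: eq_bigr => l _; rewrite mul_mx_diag mxE; ring.
rewrite E (_ : (fun k => (invmx P *m diag_mx (h k) *m P) i j) =
  (fun k => \sum_l invmx P i l * P l j * h k 0 l)); last first.
  by apply/funext => k; rewrite E.
by apply: cvg_big; [exact: add_continuous|move=> l _; apply: cvgM]; [exact: cvg_cst|exact: he].
Qed.

Lemma measurable_newton_sqrtmx A k : (forall t, posdefmx (A t)) ->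
  measurable_fun setT A -> measurable_fun setT (fun t => newton_sqrtmx (A t) k).
Proof.
move=> Apd mA.
have newton_unit t l : newton_sqrtmx (A t) l \in unitmx.
  have [P [e [Pu AE e0]]] := posdef_diagonalizable (Apd t).
  rewrite AE newton_sqrtmxE// unitmxE unitfE gt_eqF//.
  rewrite det_conj_diag// prodr_gt0// => i _; rewrite mxE.
  exact: newton_sqrt_gt0.
elim: k => [|k IH]; first exact: measurable_cst.
apply: measurable_fun_scalemx => //; apply: measurable_fun_addmx => //.
apply: measurable_fun_mulmx => //; apply: measurable_fun_invmx => // t.
exact: newton_unit.
Qed.

Lemma measurable_posdef_sqrt A : (forall t, posdefmx (A t)) ->
  measurable_fun setT A -> measurable_fun setT (fun t => posdef_sqrt (A t)).
Proof.
move=> Apd mA.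
apply: (measurable_fun_mx_cvg (h := fun k t => newton_sqrtmx (A t) k)).
  by move=> k; exact: measurable_newton_sqrtmx.
move=> t i j; have [P [e [Pu AE e0]]] := posdef_diagonalizable (Apd t).
rewrite (posdef_sqrtE (Apd t) Pu AE).
have -> : (fun k => newton_sqrtmx (A t) k i j) = (fun k =>
    (invmx P *m diag_mx (map_mx (newton_sqrt^~ k) e) *m P) i j).
  by apply/funext => k; rewrite AE newton_sqrtmxE.
apply: cvg_conj_diag => l; rewrite mxE.
rewrite (_ : (fun k => _) = newton_sqrt (e 0 l)); first exact: cvg_newton_sqrt.
by apply/funext => k; rewrite mxE.
Qed.

(** With [y = 2^-1 ^+ k * ln x], the bounds [1 + y <= expR y] and [1 - y <= expR (- y)] squeeze the
    term between [ln x] and [ln x * expR y]. The logarithm is thus reached through iterated square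
    roots, whose matrix version is measurable. *)
Lemma cvg_root_ln (x : R) : 0 < x ->
  2 ^+ k * (iter k Num.sqrt x - 1) @[k --> \oo] --> ln x.
Proof.
move=> x0.
have E k : iter k Num.sqrt x = expR (2^-1 ^+ k * ln x).
  elim: k => [|k /= ->]; first by rewrite expr0 mul1r lnK.
  have -> : 2^-1 ^+ k * ln x = 2%:R * (2^-1 ^+ k.+1 * ln x).
    by rewrite exprS mulrA mulrA divff// mul1r.
  by rewrite expRM_natl sqrtr_sqr ger0_norm// expR_ge0.
have K k : 2 ^+ k * (2^-1 ^+ k * ln x) = ln x.
  by rewrite mulrA -exprMn divff// expr1n mul1r.
apply: (@squeeze_cvgr _ _ _ _ (cst (ln x))
    (fun k => ln x * expR (2^-1 ^+ k * ln x))).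
- near=> k; rewrite E; apply/andP; split.
    rewrite -[leLHS](K k) ler_wpM2l ?exprn_ge0// lerBrDl.
    exact: expR_ge1Dx.
  rewrite -{2}(K k) -mulrA ler_wpM2l ?exprn_ge0//.
  set y := _ * ln x.
  have := expR_ge1Dx (- y); rewrite -(ler_pM2r (expR_gt0 y)).
  by rewrite -expRD addNr expR0 => h; lra.
- exact: cvg_cst.
- have half1 : `|2^-1 : R| < 1.
    by rewrite ger0_norm ?invr_ge0// invf_lt1// ltr1n.
  have y0 : 2^-1 ^+ k * ln x @[k --> \oo] --> 0 * ln x.
    by apply: cvgM; [exact: cvg_expr|exact: cvg_cst].
  have ey : expR (2^-1 ^+ k * ln x) @[k --> \oo] --> (1 : R).
    rewrite mul0r in y0; rewrite -[X in _ --> X]expR0.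
    exact: (cvg_comp _ _ y0 (@continuous_expR R 0)).
  have : ln x * expR (2^-1 ^+ k * ln x) @[k --> \oo] --> ln x * 1.
    by apply: cvgM => //; exact: cvg_cst.
  by rewrite mulr1.
Unshelve. all: by end_near. Qed.

Lemma iter_posdef_sqrtE (B P : 'M[R]_m.+1) (e : 'rV[R]_m.+1) k : posdefmx B -> P \in unitmx ->
  B = invmx P *m diag_mx e *m P ->
  posdefmx (iter k posdef_sqrt B) /\
  iter k posdef_sqrt B =
    invmx P *m diag_mx (map_mx (fun x => iter k Num.sqrt x) e) *m P.
Proof.
move=> Bpd Pu BE; elim: k => [|k [IHpd IH]] /=.
  split => //; rewrite BE; congr (_ *m diag_mx _ *m _).
  by apply/rowP => i; rewrite !mxE.
split; first exact: (posdef_sqrtP IHpd).1.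
rewrite (posdef_sqrtE IHpd Pu IH); congr (_ *m diag_mx _ *m _).
by apply/rowP => i; rewrite !mxE.
Qed.

Lemma measurable_riem_dist1 A : (forall t, posdefmx (A t)) ->
  measurable_fun setT A ->
  measurable_fun setT (fun t => riem_dist 1%:M (A t)).
Proof.
move=> Apd mA.
have sqrt_pd k t : posdefmx (iter k posdef_sqrt (A t)).
  by elim: k => [|k IH] //=; exact: (posdef_sqrtP IH).1.
have msqrt k : measurable_fun setT (fun t => iter k posdef_sqrt (A t)).
  by elim: k => [|k IH] //=; exact: measurable_posdef_sqrt.
(* [L k t] tends to the matrix logarithm of [A t], so the trace of its square tends to the squared
   distance; no eigenvalue has to be selected measurably in [t]. *)
pose L k t : 'M[R]_m.+1 := 2 ^+ k *: (iter k posdef_sqrt (A t) + (- 1)%:M).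
have mL k : measurable_fun setT (L k).
  apply: measurable_fun_scalemx; first exact: measurable_cst.
  by apply: measurable_fun_addmx => //; exact: measurable_cst.
pose S t := riem_dist 1%:M (A t) ^+ 2.
have mS : measurable_fun setT S.
  apply: (@measurable_fun_cvg _ _ _ _ (fun k t => \tr (L k t *m L k t))).
    move=> k; apply: measurable_fun_mxtrace.
    exact: measurable_fun_mulmx.
  move=> t _; have [P [e [Pu AE e0]]] := posdef_diagonalizable (Apd t).
  rewrite /S (riem_dist1E Pu AE) sqr_sqrtr ?sumr_ge0//; last first.
    by move=> i _; exact: sqr_ge0.
  have LE k : L k t = invmx P *m diag_mx
      (map_mx (fun x => 2 ^+ k * (iter k Num.sqrt x - 1)) e) *m P.
    rewrite /L (iter_posdef_sqrtE k (Apd t) Pu AE).2.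
    have -> : (- 1)%:M = invmx P *m (- 1)%:M *m P.
      by rewrite scalar_mxC -mulmxA mulVmx// mulmx1.
    rewrite -mulmxDl -mulmxDr scalemxAl scalemxAr.
    rewrite -diag_const_mx -linearD -linearZ /=; congr (_ *m diag_mx _ *m _).
    by apply/rowP => i; rewrite !mxE.
  rewrite (_ : (fun k => \tr (L k t *m L k t)) =
    (fun k => \sum_i (2 ^+ k * (iter k Num.sqrt (e 0 i) - 1)) ^+ 2)); last first.
    apply/funext => k; rewrite LE conj_diagM// tr_conj_diag//.
    by apply: eq_bigr => i _; rewrite !mxE expr2.
  by apply: cvg_big; [exact: add_continuous|move=> i _; apply: cvgM]; exact: cvg_root_ln.
have -> : (fun t => riem_dist 1%:M (A t)) = Num.sqrt \o S.
  by apply/funext => t; rewrite /= sqrtr_sqr ger0_norm// sqrtr_ge0.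
apply: measurableT_comp => //.
by apply: continuous_measurable_fun; exact: sqrt_continuous.
Qed.

End measurable_riem_dist.

(** * Powers of gamma variables *)

Section lebesgue_translation.
Context {R : realType}.
Local Notation mu := (@lebesgue_measure R).
Local Open Scope ereal_scope.

Let shift_fun (c : R) : measurableTypeR R -> measurableTypeR R :=
  fun x => (x + c)%R.

Let measurable_shift c : measurable_fun setT (shift_fun c).
Proof. exact: measurable_funD. Qed.

Lemma lebesgue_measureD (c : R) (A : set R) : measurable A ->
  pushforward mu (shift_fun c) A = mu A.
Proof.
move=> mA; apply/esym/lebesgue_measure_unique => //= _ [[a b]] _ <-.
rewrite /pushforward (_ : _ @^-1` _ = `]a - c, b - c]%classic)%R; last first.
  by apply/seteqP; split=> x /=; rewrite !in_itv/= ltrBlDr lerBrDr.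
rewrite !lebesgue_measure_itv/= !lte_fin ltrBlDr subrK.
by case: ifPn => // _; rewrite -!EFinB; congr EFin; lra.
Qed.

Lemma ge0_integral_translation (f : R -> \bar R) (c : R) :
  measurable_fun setT f -> (forall x, 0 <= f x) ->
  \int[mu]_x f (x + c)%R = \int[mu]_x f x.
Proof.
move=> mf f0.
transitivity (\int[pushforward mu (shift_fun c)]_x f x).
  by rewrite ge0_integral_pushforward.
by apply: eq_measure_integral => A mA _; exact: lebesgue_measureD.
Qed.

End lebesgue_translation.

Section measurable_expR_ln.
Context {d : measure_display} {T : measurableType d} {R : realType}.

Lemma measurable_fun_expR (f : T -> R) : measurable_fun setT f ->
  measurable_fun setT (fun x => expR (f x)).
Proof. by move=> mf; apply: measurableT_comp. Qed.

Lemma measurable_fun_ln (f : T -> R) : measurable_fun setT f ->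
  measurable_fun setT (fun x => ln (f x)).
Proof. by move=> mf; apply: measurableT_comp. Qed.

Lemma measurable_fun_boolr (f : T -> bool) : measurable_fun setT f ->
  measurable_fun setT (fun x => (f x)%:R : R).
Proof.
move=> mf; rewrite (_ : (fun _ => _) = fun x => if f x then 1 else 0).
  by apply: measurable_fun_ifT => //; exact: measurable_cst.
by apply/funext => x; case: (f x).
Qed.

End measurable_expR_ln.

Ltac measurability := repeat first
  [ exact: measurable_cst | exact: measurable_id
  | exact: measurable_fst | exact: measurable_snd | assumption
  | apply: measurable_funM | apply: measurable_funB | apply: measurable_funD
  | apply: measurable_funN | apply: measurable_funX | apply: measurable_fun_expR
  | apply: measurable_fun_ln | apply: measurable_fun_boolr
  | apply: measurable_fun_ltr | apply: measurable_fun_ler ].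

Section log_gamma.
Context {R : realType}.
Local Notation mu := (@lebesgue_measure R).
Implicit Types (p k x u U c S y : R) (phi : R -> R).

(* The density, up to a constant, of the logarithm of the k-th power of a
   gamma variable with shape kp and rate k/2. *)
Definition loggamma_ker p k u : R := expR (p * u - k / 2 * expR (u / k)).

Definition loggamma_int p k phi : \bar R :=
  (\int[mu]_u (phi u * loggamma_ker p k u)%:E)%E.

(** The exponent [p] comes from the determinant; [k / 2] comes from integrating out the [k] other
    entries of the first row, each with weight [expR (- (y ^+ 2 / (2 * x)))]. *)
Definition pivot_ker p k x : R :=
  (0 < x)%R%:R * expR ((p + k / 2) * ln x - x / 2).

(* If [x] and [u] are independent with densities proportional to
   [pivot_ker p k] and [loggamma_ker p k], then [pivot_ratio k] is, up to a
   constant, the density of [u + ln x] relative to [loggamma_ker p (k + 1)]. *)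
Definition pivot_ratio_ker k U x : R :=
  (0 < x)%R%:R * expR (k / 2 * ln x - x / 2 - k / 2 * expR ((U - ln x) / k)
                       + (k + 1) / 2 * expR (U / (k + 1))).

Definition pivot_ratio k U : \bar R :=
  (\int[mu]_x (pivot_ratio_ker k U x)%:E)%E.

Lemma loggamma_ker_ge0 p k u : 0 <= loggamma_ker p k u.
Proof. exact: expR_ge0. Qed.

Lemma pivot_ker_ge0 p k x : 0 <= pivot_ker p k x.
Proof. by rewrite mulr_ge0// expR_ge0. Qed.

Lemma pivot_ratio_ker_ge0 k U x : 0 <= pivot_ratio_ker k U x.
Proof. by rewrite mulr_ge0// expR_ge0. Qed.

Lemma measurable_loggamma_ker p k : measurable_fun setT (loggamma_ker p k).
Proof. by rewrite /loggamma_ker; measurability. Qed.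

Lemma measurable_pivot_ker p k : measurable_fun setT (pivot_ker p k).
Proof. by rewrite /pivot_ker; measurability. Qed.

Lemma measurable_pivot_ratio_ker k U :
  measurable_fun setT (pivot_ratio_ker k U).
Proof. by rewrite /pivot_ratio_ker; measurability. Qed.

Lemma loggamma_int_ge0 p k phi : (forall u, 0 <= phi u) ->
  (0 <= loggamma_int p k phi)%E.
Proof.
move=> phi0; apply: integral_ge0 => u _.
by rewrite lee_fin mulr_ge0// loggamma_ker_ge0.
Qed.

(** Here [p] cancels: the [p * ln x] of the pivot compensates the shift of [u] by [ln x], and the
    slope in [U] is the same at both stages. *)
Let pivot_kerE p k x U : k != 0 ->
  pivot_ker p k x * loggamma_ker p k (U - ln x) =
  loggamma_ker p (k + 1) U * pivot_ratio_ker k U x.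
Proof.
move=> k0; rewrite /pivot_ker /loggamma_ker /pivot_ratio_ker -mulrA [RHS]mulrCA.
by rewrite -!expRD; congr (_ * expR _); field.
Qed.

(** Translation by [ln x] in the inner integral followed by Tonelli: the law of [u + ln x] is
    expressed through its density relative to the next stage. *)
Lemma pivot_loggamma_int p k phi : k != 0 -> (forall u, 0 <= phi u) ->
  measurable_fun setT phi ->
  (\int[mu]_x ((pivot_ker p k x)%:E * loggamma_int p k (fun u => phi (u + ln x)%R))
   = \int[mu]_U ((phi U * loggamma_ker p (k + 1)%R U)%:E * pivot_ratio k U))%E.
Proof.
move=> k0 phi0 mphi.
pose g (z : R * R) := (phi z.2 * loggamma_ker p (k + 1) z.2 *
  pivot_ratio_ker k z.2 z.1)%:E.
have mg : measurable_fun setT g.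
  apply/measurable_EFinP; rewrite /g /loggamma_ker /pivot_ratio_ker.
  measurability.
  exact: (measurableT_comp mphi).
have g0 z : (0 <= g z)%E.
  by rewrite lee_fin !mulr_ge0// ?loggamma_ker_ge0 ?expR_ge0.
transitivity (\int[mu]_x \int[mu]_U g (x, U))%E.
  apply: eq_integral => x _; rewrite /loggamma_int -ge0_integralZl//; last 3 first.
  - apply/measurable_EFinP; rewrite /loggamma_ker; measurability.
    by apply: (measurableT_comp mphi); measurability.
  - by move=> u _; rewrite lee_fin mulr_ge0// loggamma_ker_ge0.
  - by rewrite lee_fin pivot_ker_ge0.
  rewrite -(ge0_integral_translation (f := fun U => g (x, U)) (ln x))//; last first.
    exact: (measurableT_comp mg).
  apply: eq_integral => u _; rewrite -EFinM /g /=; congr EFin.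
  rewrite -[RHS]mulrA -pivot_kerE// addrK; ring.
rewrite fubini_tonelli//; apply: eq_integral => U _.
rewrite /pivot_ratio -ge0_integralZl//.
- by apply/measurable_EFinP; exact: measurable_pivot_ratio_ker.
- by move=> x _; rewrite lee_fin pivot_ratio_ker_ge0.
- by rewrite lee_fin mulr_ge0// loggamma_ker_ge0.
Qed.

Lemma measurable_pivot_ratio k : measurable_fun setT (pivot_ratio k).
Proof.
apply: (@measurable_fun_fubini_tonelli_F _ _ (measurableTypeR R)
  (measurableTypeR R) _ mu (fun z => (pivot_ratio_ker k z.1 z.2)%:E)).
- by apply/measurable_EFinP; rewrite /pivot_ratio_ker; measurability.
- by move=> z; rewrite lee_fin pivot_ratio_ker_ge0.
Qed.

Let ln_ltB1 x : 0 < x -> ln x <= x - 1.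
Proof.
by move=> x0; rewrite -{2}(lnK x0) lerBrDr addrC expR_ge1Dx.
Qed.

(* Convexity of q |-> q^(-1/k), compared at q' = 1 + y / S' which is a convex
   combination of q = 1 + y / S and 1. *)
Let pivot_exponent_le k S S' y : 0 < k -> 0 < S -> S <= S' -> 0 < S + y ->
  S * (1 - expR (- ln ((S + y) / S) / k)) <=
  S' * (1 - expR (- ln ((S' + y) / S') / k)).
Proof.
move=> k0 S0 SS' Sy0.
have S'0 : 0 < S' by exact: lt_le_trans SS'.
have S'y0 : 0 < S' + y by apply: lt_le_trans Sy0 _; rewrite lerD2r.
set q := (S + y) / S; set q' := (S' + y) / S'.
have q0 : 0 < q by rewrite divr_gt0.
have q'0 : 0 < q' by rewrite divr_gt0.
set w := - ln q' / k.
(* The supporting line of [z |-> z^(-1/k)] at [q']. It is used at [q] with weight [S] and at [1]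
   with weight [S' - S]; the slopes cancel since [S * q + (S' - S) = S' * q']. *)
have tangent z : 0 < z -> expR w * (1 - (z / q' - 1) / k) <= expR (- ln z / k).
  move=> z0; have -> : - ln z / k = w - ln (z / q') / k.
    by rewrite /w [ln (z / _)]ln_div ?posrE//; ring.
  rewrite expRD ler_wpM2l ?expR_ge0//.
  apply: le_trans (expR_ge1Dx _); rewrite lerD2l lerN2 ler_wpM2r ?invr_ge0 ?(ltW k0)//.
  by apply: ln_ltB1; rewrite divr_gt0.
have t1 := tangent _ q0; have t2 := tangent _ (@ltr01 R).
rewrite ln1 oppr0 mul0r expR0 in t2.
have h1 : S * (expR w * (1 - (q / q' - 1) / k)) <= S * expR (- ln q / k).
  by rewrite ler_wpM2l// ltW.
have h2 : (S' - S) * (expR w * (1 - (1 / q' - 1) / k)) <= S' - S.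
  by rewrite -[leRHS]mulr1 ler_wpM2l// subr_ge0.
have : S * (expR w * (1 - (q / q' - 1) / k)) +
    (S' - S) * (expR w * (1 - (1 / q' - 1) / k)) = S' * expR w.
  have q'n : q' != 0 by rewrite gt_eqF.
  rewrite /q /q'; field.
  by rewrite !gt_eqF.
move: (expR _) (expR _) h1 h2 => e e' h1 h2 hh; lra.
Qed.

(* After the translation [x = expR (U / (k + 1)) + y] the integrand itself is
   nondecreasing in [U], for each [y]. *)
Lemma pivot_ratio_nondecreasing k U V : 0 < k -> U <= V ->
  (pivot_ratio k U <= pivot_ratio k V)%E.
Proof.
move=> k0 UV.
(* The exponent in [pivot_ratio_ker] is [k / 2 * ln x] minus half the gap in the AM-GM inequality
   [(k + 1) * expR (U / (k + 1)) <= x + k * expR ((U - ln x) / k)]. Equality holds at [x = S], so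
   [x] is measured from there. *)
pose S := expR (U / (k + 1)); pose S' := expR (V / (k + 1)).
have k10 : 0 < k + 1 by rewrite addr_gt0.
have SS' : S <= S' by rewrite ler_expR ler_pM2r// invr_gt0.
rewrite /pivot_ratio.
rewrite -(ge0_integral_translation (f := fun x => (pivot_ratio_ker k U x)%:E) S);
  last 2 first.
- by apply/measurable_EFinP; exact: measurable_pivot_ratio_ker.
- by move=> x; rewrite lee_fin pivot_ratio_ker_ge0.
rewrite -(ge0_integral_translation (f := fun x => (pivot_ratio_ker k V x)%:E) S');
  last 2 first.
- by apply/measurable_EFinP; exact: measurable_pivot_ratio_ker.
- by move=> x; rewrite lee_fin pivot_ratio_ker_ge0.
apply: ge0_le_integral => //.
- by move=> x _; rewrite lee_fin pivot_ratio_ker_ge0.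
- apply/measurable_EFinP; rewrite /pivot_ratio_ker; measurability.
- apply/measurable_EFinP; rewrite /pivot_ratio_ker; measurability.
move=> y _; rewrite lee_fin /pivot_ratio_ker.
rewrite !(addrC y) -/S -/S'.
have [Sy0|Sy0] := ltP 0 (S + y); last first.
  by rewrite mul0r mulr_ge0// expR_ge0.
have S'y0 : 0 < S' + y by apply: lt_le_trans Sy0 _; rewrite lerD2r.
rewrite S'y0 !mul1r ler_expR.
have E W T : T = expR (W / (k + 1)) -> 0 < T + y ->
    k / 2 * ln (T + y) - (T + y) / 2 - k / 2 * expR ((W - ln (T + y)) / k) +
    (k + 1) / 2 * T = k / 2 * ln (T + y) - y / 2 +
      k / 2 * (T * (1 - expR (- ln ((T + y) / T) / k))).
  move=> TE Ty0; have T0 : 0 < T by rewrite TE expR_gt0.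
  have -> : (W - ln (T + y)) / k = W / (k + 1) + - ln ((T + y) / T) / k.
    rewrite ln_div ?posrE// [in ln T]TE expRK; field.
    by rewrite !gt_eqF.
  by rewrite expRD -TE; ring.
rewrite (E U S)// (E V S')// lerD//.
  rewrite lerD2r ler_wpM2l ?divr_ge0 ?(ltW k0)//.
  by rewrite ler_ln ?posrE// lerD2r.
rewrite ler_wpM2l ?divr_ge0 ?(ltW k0)//.
apply: pivot_exponent_le => //; exact: expR_gt0.
Qed.

End log_gamma.

Section chebyshev.
Context {R : realType}.
Local Notation mu := (@lebesgue_measure R).
Local Open Scope ereal_scope.

Lemma ge0_integral_split (f : R -> \bar R) (c : R) :
  measurable_fun setT f -> (forall x, 0 <= f x) ->
  \int[mu]_x f x = \int[mu]_x ((x <= c)%R%:R%:E * f x) +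
                   \int[mu]_x ((c < x)%R%:R%:E * f x).
Proof.
move=> mf f0; rewrite -ge0_integralD//.
- apply: eq_integral => x _; rewrite ltNge.
  by case: (x <= c)%R; rewrite /= ?mul1e ?mul0e ?adde0 ?add0e.
- by move=> x _; rewrite mule_ge0// lee_fin.
- apply: emeasurable_funM => //; apply/measurable_EFinP.
  by apply: measurable_fun_boolr; exact: measurable_fun_ler.
- by move=> x _; rewrite mule_ge0// lee_fin.
- apply: emeasurable_funM => //; apply/measurable_EFinP.
  by apply: measurable_fun_boolr; exact: measurable_fun_ltr.
Qed.

(* Chebyshev's association inequality for a nondecreasing [r] and the
   nonincreasing indicator of [x <= c]. *)
Lemma integral_le_nondecreasing (g : R -> R) (r : R -> \bar R) (c : R) :
  measurable_fun setT g -> (forall x, (0 <= g x)%R) ->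
  measurable_fun setT r -> (forall x, 0 <= r x) ->
  (forall x y, (x <= y)%R -> r x <= r y) ->
  \int[mu]_x (((x <= c)%R%:R * g x)%:E * r x) * \int[mu]_x (g x)%:E <=
  \int[mu]_x ((x <= c)%R%:R * g x)%:E * \int[mu]_x ((g x)%:E * r x).
Proof.
move=> mg g0 mr r0 rnd.
have mEg : measurable_fun setT (EFin \o g) by exact/measurable_EFinP.
have mle : measurable_fun setT (fun x : R => (x <= c)%R%:R : R).
  by apply: measurable_fun_boolr; exact: measurable_fun_ler.
have mlt : measurable_fun setT (fun x : R => (c < x)%R%:R : R).
  by apply: measurable_fun_boolr; exact: measurable_fun_ltr.
rewrite (ge0_integral_split c mEg)//.
rewrite (ge0_integral_split c (f := fun x => (g x)%:E * r x))//; last 2 first.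
- exact: emeasurable_funM.
- by move=> x; rewrite mule_ge0// lee_fin.
set A := \int[mu]_x _; set H := \int[mu]_x _; set H' := \int[mu]_x _.
set A' := \int[mu]_x _; set B := \int[mu]_x _.
have -> : A' = A by apply: eq_integral => x _; rewrite EFinM muleA.
have ge0 (f : R -> \bar R) : (forall x, 0 <= f x) -> 0 <= \int[mu]_x f x.
  by move=> f0; exact: integral_ge0.
have A0 : 0 <= A.
  by apply: ge0 => x; rewrite mule_ge0// lee_fin mulr_ge0.
have H0 : 0 <= H by apply: ge0 => x; rewrite mule_ge0// lee_fin.
have H'0 : 0 <= H' by apply: ge0 => x; rewrite mule_ge0// lee_fin.
have B0 : 0 <= B.
  by apply: ge0 => x; rewrite mule_ge0// ?mule_ge0// lee_fin.
(* The value [r c] separates those of [r] on the two sides of [c]. Once the common term [A * H] is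
   removed, only [A * H' <= H * B] is left. *)
have AH : A <= r c * H.
  rewrite -ge0_integralZl//; last 2 first.
  - by apply: emeasurable_funM => //; exact/measurable_EFinP.
  - by move=> x _; rewrite mule_ge0// lee_fin.
  apply: ge0_le_integral => //.
  - by move=> x _; rewrite mule_ge0// lee_fin mulr_ge0.
  - by apply: emeasurable_funM => //; apply/measurable_EFinP; exact: measurable_funM.
  - apply: emeasurable_funM => //; apply: emeasurable_funM => //.
    exact/measurable_EFinP.
  move=> x _; rewrite EFinM muleAC -muleA [leLHS]muleCA.
  case: (leP x c) => xc /=; last by rewrite !mul0e !mule0.
  by rewrite !mul1e lee_wpmul2r ?lee_fin ?rnd.
have BH : r c * H' <= B.
  rewrite -ge0_integralZl//; last 2 first.
  - by apply: emeasurable_funM => //; exact/measurable_EFinP.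
  - by move=> x _; rewrite mule_ge0// lee_fin.
  apply: ge0_le_integral => //.
  - by move=> x _; rewrite mule_ge0// mule_ge0// lee_fin.
  - apply: emeasurable_funM => //; apply: emeasurable_funM => //.
    exact/measurable_EFinP.
  - apply: emeasurable_funM => //; first exact/measurable_EFinP.
    exact: emeasurable_funM.
  move=> x _; case: (ltP c x) => xc /=; last by rewrite !mul0e mule0.
  by rewrite !mul1e [leRHS]muleC lee_wpmul2r ?lee_fin// rnd// ltW.
rewrite (ge0_muleDr A H0 H'0) (ge0_muleDr H A0 B0) [A * H]muleC leeD2l//.
apply: (@le_trans _ _ (r c * H * H')); first by rewrite lee_wpmul2r.
by rewrite muleAC muleC lee_wpmul2l.
Qed.

End chebyshev.

Section loggamma_mass.
Context {R : realType}.
Local Notation mu := (@lebesgue_measure R).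
Implicit Types p k c u : R.
Local Open Scope ereal_scope.

(** In terms of laws: stage [k] plus an independent [ln x] is stochastically above stage [k + 1]. It
    is Chebyshev's inequality for the weight [loggamma_ker p (k + 1)] and the nondecreasing
    [pivot_ratio k]. *)
Lemma pivot_loggamma_domination p k c : (0 < k)%R ->
  (\int[mu]_x ((pivot_ker p k x)%:E *
     loggamma_int p k (fun u => (u + ln x <= c)%R%:R))) *
    loggamma_int p (k + 1) (fun=> 1%R) <=
  loggamma_int p (k + 1) (fun u => (u <= c)%R%:R) *
    (\int[mu]_x ((pivot_ker p k x)%:E * loggamma_int p k (fun=> 1%R))).
Proof.
move=> k0; have kn0 : k != 0%R by rewrite gt_eqF.
rewrite (pivot_loggamma_int p (phi := fun u => (u <= c)%R%:R) kn0)//; last first.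
  by apply: measurable_fun_boolr; exact: measurable_fun_ler.
rewrite (pivot_loggamma_int p (phi := fun u => 1%R) kn0)//.
have -> : \int[mu]_u ((1 * loggamma_ker p (k + 1) u)%:E * pivot_ratio k u) =
    \int[mu]_u ((loggamma_ker p (k + 1) u)%:E * pivot_ratio k u).
  by apply: eq_integral => u _; rewrite mul1r.
have -> : loggamma_int p (k + 1) (fun=> 1%R) =
    \int[mu]_u (loggamma_ker p (k + 1) u)%:E.
  by apply: eq_integral => u _; rewrite mul1r.
apply: integral_le_nondecreasing.
- exact: measurable_loggamma_ker.
- by move=> x; exact: loggamma_ker_ge0.
- exact: measurable_pivot_ratio.
- by move=> x; apply: integral_ge0 => y _; rewrite lee_fin pivot_ratio_ker_ge0.
- by move=> x y; exact: pivot_ratio_nondecreasing.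
Qed.

Lemma loggamma_mass_gt0 p k : (0 < p)%R -> (0 < k)%R ->
  0 < loggamma_int p k (fun=> 1%R).
Proof.
move=> p0 k0; pose C := expR (- (k / 2 * expR (1 / k))).
have C0 : (0 < C)%R by exact: expR_gt0.
apply: (@lt_le_trans _ _ (\int[mu]_(x in `[0%R, 1%R]) C%:E)).
  rewrite integral_cst//= lebesgue_measure_itv/= lte01.
  by rewrite oppr0 adde0 mule1 lte_fin.
rewrite /loggamma_int integral_mkcond; apply: ge0_le_integral => //.
- by move=> x _; rewrite patchE; case: ifP => // _; rewrite lee_fin ltW.
- by apply/(measurable_restrictT (fun=> C%:E)).
- by apply/measurable_EFinP; apply: measurable_funM => //;
    exact: measurable_loggamma_ker.
move=> x _; rewrite patchE mul1r; case: ifPn => [|_]; last first.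
  by rewrite lee_fin loggamma_ker_ge0.
rewrite inE/= in_itv/= => /andP[x0 x1]; rewrite lee_fin ler_expR.
rewrite -[leLHS]add0r lerD ?mulr_ge0 ?(ltW p0)// lerN2.
by rewrite ler_wpM2l ?divr_ge0 ?(ltW k0)// ler_expR ler_pM2r ?invr_gt0.
Qed.

(** Weighted AM-GM for [expR (u / k)] with weight [k] and [1] with weight 1: [(k + 1) * expR (u / (k
    + 1)) <= k * expR (u / k) + 1]. The last term produces the constant [expR (2^-1)]. *)
Lemma loggamma_ker_le p k u : (0 < k)%R ->
  (loggamma_ker p k u <= expR (2^-1) * loggamma_ker p (k + 1) u)%R.
Proof.
move=> k0; have k10 : (0 < k + 1)%R by rewrite addr_gt0.
rewrite -expRD ler_expR; pose w : R := (u / (k + 1))%R.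
have -> : (u / k = w + w / k)%R.
  by rewrite /w; field; rewrite !gt_eqF.
rewrite -/w expRD.
have h1 := expR_ge1Dx (w / k); have h2 := expR_ge1Dx (- w).
have h3 : (k + 1 <= k * expR (w / k) + expR (- w))%R.
  have : (k * (1 + w / k) <= k * expR (w / k))%R by rewrite ler_wpM2l// ltW.
  have -> : (k * (1 + w / k) = k + w)%R by field; rewrite gt_eqF.
  lra.
have := ler_wpM2l (expR_ge0 w) h3.
rewrite [(expR w * (k * _ + _))%R]mulrDr -[(expR w * expR (- w))%R]expRD subrr expR0.
by move: (expR w) (expR (w / k)) => a b h; lra.
Qed.

(** Finiteness is supplied by the chi-squared law at the final stage; this brings it down to the
    earlier stages met in the induction. *)
Lemma loggamma_mass_fin p k : (0 < k)%R ->
  loggamma_int p (k + 1) (fun=> 1%R) < +oo ->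
  loggamma_int p k (fun=> 1%R) < +oo.
Proof.
move=> k0 fin; have m1 l : measurable_fun setT (fun u => (1 * loggamma_ker p l u)%:E).
  by apply/measurable_EFinP; apply: measurable_funM => //;
    exact: measurable_loggamma_ker.
apply: (@le_lt_trans _ _
    ((expR 2^-1)%:E * loggamma_int p (k + 1) (fun=> 1%R))); last first.
  by rewrite lte_mul_pinfty// lee_fin expR_ge0.
rewrite -ge0_integralZl//; last 2 first.
- exact: m1.
- by move=> u _; rewrite lee_fin mul1r loggamma_ker_ge0.
apply: ge0_le_integral => //.
- by move=> u _; rewrite lee_fin mul1r loggamma_ker_ge0.
- exact: m1.
- by apply: emeasurable_funM => //; exact: m1.
- by move=> u _; rewrite -EFinM lee_fin !mul1r loggamma_ker_le.
Qed.

End loggamma_mass.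

(** * Change of variables from gamma to log-gamma densities *)

Section exponential_substitution.
Context {R : realType}.
Local Notation mu := (@lebesgue_measure R).
Implicit Types (a b c k x u : R).

Variables (k b : R).
Hypothesis k0 : 0 < k.

(** The inverse of [x |-> k * ln (x / k)], the logarithm of [(x / k)^k]. It carries the gamma weight
    [G] to a multiple of [loggamma_ker] with [p = (b + 1) / k]. *)
Let F u : R := k * expR (u / k).

Let F_gt0 u : 0 < F u. Proof. by rewrite mulr_gt0// expR_gt0. Qed.

Let F_lt u v : u < v -> F u < F v.
Proof. by move=> uv; rewrite ltr_pM2l// ltr_expR ltr_pM2r// invr_gt0. Qed.

Let F_le u v : (F u <= F v) = (u <= v).
Proof.
by rewrite ler_pM2l// ler_expR ler_pM2r// invr_gt0.
Qed.

Let is_derive_F u : is_derive u 1 F (expR (u / k)).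
Proof.
have h : is_derive u 1 (fun u : R => u / k) k^-1.
  by apply: is_derive_eq; rewrite scaler0 add0r scaler1.
have h' := @is_derive1_comp R expR (fun u => u / k) u _ _ (is_derive_expR (u / k)) h.
have h2 := @is_deriveZ _ _ _ _ k _ _ _ h'.
by apply: is_derive_eq; rewrite /GRing.scale/= mulrC divfK// gt_eqF.
Qed.

Let F'E : (F^`())%classic = fun u => expR (u / k).
Proof. by apply/funext => u; rewrite derive1E; apply: derive_val. Qed.

Let G x : R := expR (b * ln x - x / 2).

Let continuous_F' : continuous (fun u => expR (u / k)).
Proof.
move=> u; apply: (cvg_comp (fun u => u / k) expR); last exact: continuous_expR.
by apply: cvgM; [exact: cvg_id|exact: cvg_cst].
Qed.

Let continuous_G x : 0 < x -> {for x, continuous G}.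
Proof.
move=> x0; apply: (cvg_comp (fun x => b * ln x - x / 2) expR); last exact: continuous_expR.
apply: cvgB.
  by apply: cvgM; [exact: cvg_cst|exact: continuous_ln].
by apply: cvgM; [exact: cvg_id|exact: cvg_cst].
Qed.

Let subst_itv u v : u <= v ->
  (\int[mu]_(x in `[F u, F v]) (G x)%:E =
   \int[mu]_(w in `[u, v]) (G (F w) * expR (w / k))%:E)%E.
Proof.
move=> uv; rewrite (integration_by_substitution_increasing uv) ?F'E//.
- by move=> x y _ _; exact: F_lt.
- by apply: (cvgP (expR (u / k))); apply: cvg_at_right_filter; exact: continuous_F'.
- by apply: (cvgP (expR (v / k))); apply: cvg_at_left_filter; exact: continuous_F'.
- have cF x : {for x, continuous F}.
    apply: cvgM; first exact: cvg_cst.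
    exact: continuous_F'.
  split.
  + by move=> x _; exact: (is_derive_F x).(ex_derive).
  + by apply: cvg_at_right_filter; exact: cF.
  + by apply: cvg_at_left_filter; exact: cF.
- apply: continuous_in_subspaceT => x.
  rewrite inE/= in_itv/= => /andP[Fx _].
  by apply: continuous_G; exact: lt_le_trans Fx.
Qed.

(** Substitution on compact intervals passes to increasing unions by monotone convergence; this
    covers both the half-line of a distribution function and the whole line of a total mass. *)
Let subst_bigcup (s t : nat -> R) : (forall n, s n <= t n) ->
  {homo s : n p / (n <= p)%N >-> p <= n} ->
  {homo t : n p / (n <= p)%N >-> n <= p} ->
  (\int[mu]_(x in \bigcup_n `[F (s n), F (t n)]%classic) (G x)%:E =
   \int[mu]_(w in \bigcup_n `[s n, t n]%classic) (G (F w) * expR (w / k))%:E)%E.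
Proof.
move=> st snd tnd.
have mG : measurable_fun setT G by rewrite /G; measurability.
have mGF : measurable_fun setT (fun w => G (F w) * expR (w / k)).
  by rewrite /G /F; measurability.
have L : (\int[mu]_(x in `[F (s n), F (t n)]) (G x)%:E)%E @[n --> \oo] -->
    (\int[mu]_(x in \bigcup_n `[F (s n), F (t n)]%classic) (G x)%:E)%E.
  apply: ge0_nondecreasing_set_cvg_integral => //.
  - move=> n p np; apply/subsetPset/subset_itv; rewrite bnd_simp F_le.
      exact: snd.
    exact: tnd.
  - by move=> n; apply/measurable_EFinP; exact: measurable_funTS.
  - by move=> n x _; rewrite lee_fin expR_ge0.
have L' : (\int[mu]_(w in `[s n, t n]) (G (F w) * expR (w / k))%:E)%E @[n --> \oo] -->
    (\int[mu]_(w in \bigcup_n `[s n, t n]%classic) (G (F w) * expR (w / k))%:E)%E.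
  apply: ge0_nondecreasing_set_cvg_integral => //.
  - by move=> n p np; apply/subsetPset/subset_itv; rewrite bnd_simp; [exact: snd|exact: tnd].
  - by move=> n; apply/measurable_EFinP; exact: measurable_funTS.
  - by move=> n x _; rewrite lee_fin mulr_ge0// expR_ge0.
have E : (fun n => \int[mu]_(x in `[F (s n), F (t n)]) (G x)%:E)%E =
    (fun n => \int[mu]_(w in `[s n, t n]) (G (F w) * expR (w / k))%:E)%E.
  by apply/funext => n; rewrite subst_itv.
by rewrite E in L; exact: (cvg_unique _ L L').
Qed.

Let exp_substE u : G (F u) * expR (u / k) =
  expR (b * ln k) * expR ((b + 1) / k * u - k / 2 * expR (u / k)).
Proof.
rewrite /G /F lnM ?posrE ?expR_gt0// expRK -!expRD; congr expR.
by field; rewrite gt_eqF.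
Qed.

Let exists_nat_ge x : exists n : nat, x <= n%:R.
Proof.
exists (Num.bound `|x|); apply: le_trans (ler_norm x) _.
by apply/ltW/archi_boundP.
Qed.

Let FK x : 0 < x -> F (k * ln (x / k)) = x.
Proof.
move=> x0; rewrite /F mulrC [k * ln _]mulrC mulfK ?gt_eqF// lnK ?posrE ?divr_gt0//.
by rewrite divfK// gt_eqF.
Qed.

Let measurable_ker : measurable_fun setT
  (fun u => (expR ((b + 1) / k * u - k / 2 * expR (u / k)))%:E).
Proof. by apply/measurable_EFinP; measurability. Qed.

Lemma gamma_cdf_substitution c :
  (\int[mu]_(x in `]0%R, (k * expR (c / k))%R]) (expR (b * ln x - x / 2))%:E =
   (expR (b * ln k))%:E *
   \int[mu]_u ((u <= c)%R%:R * expR ((b + 1) / k * u - k / 2 * expR (u / k)))%:E)%E.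
Proof.
pose s n : R := c - n%:R.
have sc n : s n <= c by rewrite /s gerBl.
have -> : `]0%R, k * expR (c / k)]%classic = \bigcup_n `[F (s n), F c]%classic.
  apply/seteqP; split=> x /=; rewrite in_itv/=.
    move=> /andP[x0 xc]; have [n cn] := exists_nat_ge (c - k * ln (x / k)).
    exists n => //=; rewrite in_itv/= xc andbT -[leRHS](FK x0) F_le /s.
    by rewrite lerBlDr -lerBlDl.
  move=> [n _ /=]; rewrite in_itv/= => /andP[Fx ->]; rewrite andbT.
  exact: lt_le_trans Fx.
rewrite (subst_bigcup sc)//; last first.
  by move=> n p np; rewrite lerD2l lerN2 ler_nat.
have -> : \bigcup_n `[s n, c]%classic = `]-oo, c]%classic.
  apply/seteqP; split=> x /=; rewrite in_itv/=.
    by move=> [n _ /=]; rewrite in_itv/= => /andP[].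
  move=> xc; have [n cn] := exists_nat_ge (c - x).
  exists n => //=; rewrite in_itv/= xc andbT /s.
  by rewrite lerBlDr -lerBlDl.
rewrite -ge0_integralZl//; last by apply/measurable_EFinP; measurability.
rewrite [LHS]integral_mkcond; apply: eq_integral => u _.
rewrite patchE exp_substE; case: ifPn; rewrite ?inE ?notin_setE/= in_itv/=.
  by move=> ->; rewrite mul1r.
by move=> /negP/negbTE ->; rewrite mul0r mule0.
Qed.

Lemma gamma_mass_substitution :
  (\int[mu]_(x in `]0%R, +oo[) (expR (b * ln x - x / 2))%:E =
   (expR (b * ln k))%:E *
   \int[mu]_u (expR ((b + 1) / k * u - k / 2 * expR (u / k)))%:E)%E.
Proof.
pose t n : R := n%:R.
have st n : - t n <= t n by rewrite lerNl (le_trans _ (ler0n _ n))// oppr_le0.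
have -> : `]0%R, +oo[%classic = \bigcup_n `[F (- t n), F (t n)]%classic.
  apply/seteqP; split=> x /=; rewrite in_itv/= ?andbT.
    move=> x0; have [n cn] := exists_nat_ge `|k * ln (x / k)|.
    exists n => //=; rewrite in_itv/= -[x](FK x0) !F_le.
    by rewrite -ler_norml.
  move=> [n _ /=]; rewrite in_itv/= => /andP[Fx _].
  exact: lt_le_trans Fx.
rewrite (subst_bigcup st); last 2 first.
- by move=> n p np; rewrite lerN2 ler_nat.
- by move=> n p np; rewrite ler_nat.
have -> : \bigcup_n `[- t n, t n]%classic = setT.
  apply/seteqP; split=> // x _; have [n cn] := exists_nat_ge `|x|.
  by exists n => //=; rewrite in_itv/= -ler_norml.
rewrite -ge0_integralZl//.
by apply: eq_integral => u _; rewrite exp_substE EFinM.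
Qed.

End exponential_substitution.

(** * Integration over the upper triangle *)

Section lebesgue_seq.
Context {R : realType}.
Local Notation RR := (measurableTypeR R).
Local Notation mu := (@lebesgue_measure R).
Implicit Types (k m : nat) (f : seq R -> \bar R) (x : R).
Local Open Scope ereal_scope.

(* Integrating over sequences rather than tuples frees the sizes from
   dependent-type constraints. *)
Definition lebesgue_seq k f : \bar R :=
  \int[@lebesgue_tuple R k]_v f (val v).

Definition seq_measurable k f :=
  measurable_fun [set: k.-tuple RR] (fun v : k.-tuple RR => f (val v)).

Lemma lebesgue_seq_ge0 k f : (forall s, 0 <= f s) -> 0 <= lebesgue_seq k f.
Proof. by move=> f0; apply: integral_ge0 => v _. Qed.

Lemma eq_lebesgue_seq k f g : (forall s, size s = k -> f s = g s) ->
  lebesgue_seq k f = lebesgue_seq k g.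
Proof. by move=> fg; apply: eq_integral => v _; rewrite fg// size_tuple. Qed.

Lemma lebesgue_seq0 f : (forall s, 0 <= f s) -> lebesgue_seq 0 f = f [::].
Proof.
move=> f0; rewrite /lebesgue_seq /= integral_dirac//.
  by rewrite diracT mul1e.
rewrite (_ : (fun v => _) = cst (f [::])); first exact: measurable_cst.
by apply/funext => v; rewrite tuple0.
Qed.

Lemma seq_measurable_cons_pair k f : seq_measurable k.+1 f ->
  measurable_fun setT (fun z : RR * k.-tuple RR => f (z.1 :: val z.2)).
Proof.
by move=> mf; exact: (measurableT_comp mf (@measurable_cons_tuple R k)).
Qed.

Lemma seq_measurable_cons k f x : seq_measurable k.+1 f ->
  seq_measurable k (fun s => f (x :: s)).
Proof.
move=> /seq_measurable_cons_pair mf.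
exact: (measurable_fun_pair2 x mf).
Qed.

Lemma lebesgue_seqS k f : (forall s, 0 <= f s) -> seq_measurable k.+1 f ->
  lebesgue_seq k.+1 f = \int[mu]_x lebesgue_seq k (fun s => f (x :: s)).
Proof.
move=> f0 mf; rewrite /lebesgue_seq /=.
transitivity (\int[pushforward (mu \x lebesgue_tuple k) (@Defs.cons_tuple R k)]_v
    f (val v)); first by [].
rewrite ge0_integral_pushforward//; last exact: measurable_cons_tuple.
rewrite preimage_setT.
rewrite (fubini_tonelli1 (fun z : RR * k.-tuple RR => f (z.1 :: val z.2)))//.
exact: seq_measurable_cons_pair.
Qed.

Lemma measurable_lebesgue_seq d (T : measurableType d) k
    (g : T -> seq R -> \bar R) : (forall t s, 0 <= g t s) ->
  measurable_fun setT (fun z : T * k.-tuple RR => g z.1 (val z.2)) ->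
  measurable_fun setT (fun t => lebesgue_seq k (g t)).
Proof.
move=> g0 mg.
exact: (@measurable_fun_fubini_tonelli_F _ _ T (k.-tuple RR : measurableType _)
  R (lebesgue_tuple k) (fun z => g z.1 (val z.2))).
Qed.

Lemma measurable_cat_tuple m k :
  measurable_fun setT (fun z : m.-tuple RR * k.-tuple RR =>
    [the (m + k).-tuple RR of val z.1 ++ val z.2]).
Proof.
apply/measurable_fun_tnthP => i.
have [im|im] := ltnP i m.
  rewrite (_ : _ \o _ = (fun v : m.-tuple RR => tnth v (Ordinal im)) \o fst).
    by apply: measurableT_comp => //; exact: measurable_tnth.
  apply/funext => z /=; rewrite (tnth_nth 0%R) [RHS](tnth_nth 0%R) /=.
  by rewrite nth_cat size_tuple im.
have ik : (i - m < k)%N by rewrite ltn_subLR.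
rewrite (_ : _ \o _ = (fun v : k.-tuple RR => tnth v (Ordinal ik)) \o snd).
  by apply: measurableT_comp => //; exact: measurable_tnth.
apply/funext => z /=; rewrite (tnth_nth 0%R) [RHS](tnth_nth 0%R) /=.
by rewrite nth_cat size_tuple ltnNge im.
Qed.

Lemma seq_measurable_cat_pair m k f : seq_measurable (m + k) f ->
  measurable_fun setT
    (fun z : m.-tuple RR * k.-tuple RR => f (val z.1 ++ val z.2)).
Proof.
by move=> mf; exact: (measurableT_comp mf (@measurable_cat_tuple m k)).
Qed.

Lemma lebesgue_seqD m k f : (forall s, 0 <= f s) -> seq_measurable (m + k) f ->
  lebesgue_seq (m + k) f =
  lebesgue_seq m (fun s => lebesgue_seq k (fun t => f (s ++ t))).
Proof.
elim: m f => [|m IH] f f0 mf.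
  by rewrite lebesgue_seq0// => s; exact: lebesgue_seq_ge0.
rewrite addSn lebesgue_seqS// lebesgue_seqS//; last 2 first.
- by move=> s; exact: lebesgue_seq_ge0.
- apply: measurable_lebesgue_seq => //.
  exact: (@seq_measurable_cat_pair m.+1 k).
apply: eq_integral => x _; rewrite IH//.
exact: seq_measurable_cons.
Qed.

Definition add_seq (t s : seq R) : seq R := [seq (p.1 + p.2)%R | p <- zip t s].

Lemma size_add_seq t s : size t = size s -> size (add_seq t s) = size s.
Proof. by move=> ts; rewrite size_map size_zip ts minnn. Qed.

Lemma nth_add_seq t s i : size t = size s ->
  (nth 0 (add_seq t s) i = nth 0 t i + nth 0 s i)%R.
Proof.
elim: t s i => [|a t IH] [|b s] i //=; first by rewrite !nth_nil addr0.
by case=> ts; case: i => //= i; exact: IH.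
Qed.

Lemma seq_measurable_add_seq k f t : size t = k -> seq_measurable k f ->
  seq_measurable k (fun s => f (add_seq t s)).
Proof.
move=> tk mf.
pose g (v : k.-tuple RR) : k.-tuple RR :=
  [tuple (nth 0%R t i + tnth v i)%R | i < k].
have gE v : val (g v) = add_seq t (val v).
  apply: (@eq_from_nth _ 0%R).
    by rewrite size_add_seq ?tk !size_tuple.
  move=> i; rewrite size_tuple => ik.
  rewrite nth_add_seq ?size_tuple// (_ : i = val (Ordinal ik))//.
  by rewrite -tnth_nth tnth_mktuple -tnth_nth.
rewrite /seq_measurable.
rewrite (_ : (fun v => _) = (fun v : k.-tuple RR => f (val v)) \o g); last first.
  by apply/funext => v /=; rewrite -gE.
apply: (measurableT_comp mf); apply/measurable_fun_tnthP => i.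
rewrite (_ : _ \o _ = fun v => (nth 0 t i + tnth v i)%R); last first.
  by apply/funext => v /=; rewrite tnth_mktuple.
by apply: measurable_funD => //; exact: measurable_tnth.
Qed.

(** For a fixed pivot and first row, the lower right block and its Schur complement differ by a
    constant symmetric matrix, so this invariance lets one replace the other as integration
    variable. *)
Lemma lebesgue_seq_translation k f t : size t = k ->
  (forall s, 0 <= f s) -> seq_measurable k f ->
  lebesgue_seq k (fun s => f (add_seq t s)) = lebesgue_seq k f.
Proof.
elim: k t f => [|k IH] t f.
  by move=> /size0nil -> f0 mf; rewrite !lebesgue_seq0.
case: t => //= a t [tk] f0 mf.
rewrite !lebesgue_seqS//; last first.
  by apply: seq_measurable_add_seq => //=; congr _.+1.
rewrite -[RHS](ge0_integral_translation a)//; last 2 first.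
- apply: measurable_lebesgue_seq => //.
  exact: seq_measurable_cons_pair.
- by move=> x; exact: lebesgue_seq_ge0.
apply: eq_integral => x _; rewrite addrC.
by rewrite -(IH t (fun s => f ((a + x)%R :: s)))//; exact: seq_measurable_cons.
Qed.

Lemma lebesgue_seqZl k f (c : \bar R) : (forall s, 0 <= f s) ->
  seq_measurable k f -> 0 <= c ->
  lebesgue_seq k (fun s => c * f s) = c * lebesgue_seq k f.
Proof. by move=> f0 mf c0; exact: ge0_integralZl. Qed.

Lemma seq_measurable_prod k (h : R -> R) : measurable_fun setT h ->
  seq_measurable k (fun s => (\prod_(y <- s) h y)%:E).
Proof.
move=> mh; apply/measurable_EFinP.
rewrite (_ : (fun v => _) = fun v : k.-tuple RR => (\prod_(i < k) h (tnth v i))%R).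
  apply: measurable_prod => i _; apply: (measurableT_comp mh).
  exact: measurable_tnth.
by apply/funext => v; rewrite big_tuple.
Qed.

Lemma lebesgue_seq_prod k (h : R -> R) : measurable_fun setT h ->
  (forall x, 0 <= h x)%R ->
  lebesgue_seq k (fun s => (\prod_(y <- s) h y)%:E) =
  (\int[mu]_x (h x)%:E) ^+ k.
Proof.
move=> mh h0; have p0 s : 0 <= (\prod_(y <- s) h y)%:E.
  by rewrite lee_fin prodr_ge0.
have mp n := @seq_measurable_prod n h mh.
elim: k => [|k IH]; first by rewrite lebesgue_seq0// big_nil expe0.
rewrite lebesgue_seqS// expeS.
have H0 : 0 <= \int[mu]_x (h x)%:E.
  by apply: integral_ge0 => x _; rewrite lee_fin.
rewrite muleC -ge0_integralZl//; last 3 first.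
- exact/measurable_EFinP.
- by move=> x _; rewrite lee_fin.
- by rewrite expe_ge0.
apply: eq_integral => x _; rewrite -IH [RHS]muleC.
rewrite -lebesgue_seqZl// ?lee_fin//.
by apply: eq_lebesgue_seq => s _; rewrite big_cons EFinM.
Qed.

End lebesgue_seq.

(** * Schur complements of the first entry *)

Section schur.
Context {R : realType} {m : nat}.
Implicit Types (x : R) (r : 'rV[R]_m) (Y : 'M[R]_m).

Definition bordered_mx x r Y : 'M[R]_(1 + m) := block_mx x%:M r r^T Y.

Definition schur_mx x r Y : 'M[R]_m := Y - x^-1 *: (r^T *m r).

Let L x r : 'M[R]_(1 + m) := block_mx 1%:M 0 (x^-1 *: r^T) 1%:M.

Let L_unit x r : L x r \in unitmx.
Proof. by rewrite unitmxE det_lblock !det1 mulr1 unitr1. Qed.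

(** One step of block LDL^T elimination: a congruence by a triangular matrix of determinant 1, so
    definiteness and determinant are read off the block diagonal factor. *)
Let bordered_mxE x r Y : x != 0 -> bordered_mx x r Y =
  L x r *m block_mx x%:M 0 0 (schur_mx x r Y) *m (L x r)^T.
Proof.
move=> x0; rewrite /L tr_block_mx !mulmx_block !trmx1 trmx0 linearZ /= trmxK.
rewrite !(mul1mx, mulmx1, mul0mx, mulmx0, addr0, add0r).
rewrite /bordered_mx -scalemxAl mul_mx_scalar scalerA mulVf// scale1r.
rewrite -scalemxAr mul_scalar_mx scalerA mulVf// scale1r; congr block_mx.
by rewrite /schur_mx -scalemxAr addrC subrK.
Qed.

Let posdef_block_diag x Y :
  posdefmx (block_mx x%:M 0 0 Y : 'M[R]_(1 + m)) <-> 0 < x /\ posdefmx Y.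
Proof.
have E (u : 'rV[R]_(1 + m)) : (u *m (block_mx x%:M 0 0 Y) *m u^T) 0 0 =
    x * lsubmx u 0 0 ^+ 2 + (rsubmx u *m Y *m (rsubmx u)^T) 0 0.
  rewrite -{1 2}[u]hsubmxK tr_row_mx mul_row_block mul_row_col.
  rewrite !mulmx0 addr0 add0r mxE mul_mx_scalar -scalemxAl mxE; congr (_ * _ + _).
  by rewrite mxE big_ord1 [X in _ * X]mxE expr2.
split=> [[Bs Bp]|[x0 [Ys Yp]]].
  split.
    have u0 : row_mx (1%:M : 'M[R]_1) (0 : 'rV[R]_m) != 0.
      apply/eqP => /(congr1 lsubmx); rewrite row_mxKl => /matrixP/(_ 0 0).
      by rewrite !mxE => /eqP; rewrite oner_eq0.
    have := Bp _ u0; rewrite E row_mxKl row_mxKr !mul0mx [X in _ + X]mxE addr0.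
    by rewrite mxE expr1n mulr1.
  split.
    by move: Bs; rewrite tr_block_mx => /(congr1 drsubmx); rewrite !block_mxKdr.
  move=> v v0.
  have u0 : row_mx (0 : 'M[R]_1) v != 0.
    by apply: contra_neq v0 => /(congr1 rsubmx); rewrite row_mxKr linear0.
  have := Bp _ u0; rewrite E row_mxKl row_mxKr.
  by rewrite mxE expr0n mulr0 add0r.
split; first by rewrite tr_block_mx !trmx0 tr_scalar_mx Ys.
move=> u u0; rewrite E.
have [r0|r0] := eqVneq (rsubmx u) 0.
  rewrite r0 !mul0mx [X in _ + X]mxE addr0 mulr_gt0// exprn_even_gt0//=.
  apply: contra_neq u0 => l0; rewrite -[u]hsubmxK r0.
  rewrite (_ : lsubmx u = 0) ?row_mx0//.
  by apply/matrixP => i j; rewrite !ord1 l0 mxE.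
by apply: ltr_wpDl; [rewrite mulr_ge0 ?sqr_ge0// ltW|exact: Yp].
Qed.

Lemma posdef_bordered_mx x r Y :
  posdefmx (bordered_mx x r Y) <-> 0 < x /\ posdefmx (schur_mx x r Y).
Proof.
(* Elimination divides by [x], so the pivot is shown positive beforehand, by evaluating the
   quadratic form at the first basis vector. *)
suff pos : posdefmx (bordered_mx x r Y) -> 0 < x.
  have key : 0 < x -> posdefmx (bordered_mx x r Y) <->
      0 < x /\ posdefmx (schur_mx x r Y).
    move=> x0; rewrite -posdef_block_diag bordered_mxE ?gt_eqF//.
    split=> pd; last exact: posdef_congruence.
    have Lu := L_unit x r; have LVu : invmx (L x r) \in unitmx by rewrite unitmx_inv.
    have := posdef_congruence pd LVu; rewrite trmx_inv !mulmxA mulVmx//.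
    by rewrite mul1mx mulmxK// unitmx_tr.
  by split=> [h|[h1 h2]]; [exact: (key (pos h)).1|exact: (key h1).2].
move=> [_ Bp].
have u0 : row_mx (1%:M : 'M[R]_1) (0 : 'rV[R]_m) != 0.
  apply/eqP => /(congr1 lsubmx); rewrite row_mxKl => /matrixP/(_ 0 0).
  by rewrite !mxE => /eqP; rewrite oner_eq0.
have := Bp _ u0; rewrite mul_row_block tr_row_mx mul_row_col.
rewrite !mul0mx !addr0 mul1mx trmx0 mulmx0 addr0 trmx1 mulmx1.
by rewrite mxE eqxx mulr1n.
Qed.

Lemma det_bordered_mx x r Y : x != 0 ->
  \det (bordered_mx x r Y) = x * \det (schur_mx x r Y).
Proof.
move=> x0; rewrite bordered_mxE// !det_mulmx det_tr det_lblock !det1 !mulr1.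
by rewrite mul1r det_ublock det_scalar1.
Qed.

(** The last term is what turns [expR (- (\tr A / 2))] into a Gaussian weight on the first row. *)
Lemma tr_bordered_mx x r Y :
  \tr (bordered_mx x r Y) =
  x + \tr (schur_mx x r Y) + (\sum_i r 0 i ^+ 2) / x.
Proof.
rewrite mxtrace_block mxtrace_scalar mulr1n /schur_mx linearB linearZ /=.
rewrite (_ : \tr (r^T *m r) = \sum_i r 0 i ^+ 2).
  by rewrite mulrC -addrA subrK.
by apply: eq_bigr => i _; rewrite !mxE big_ord1 !mxE -expr2.
Qed.

Lemma symmetric_mx_bordered (A : 'M[R]_(1 + m)) : A^T = A ->
  A = bordered_mx (A 0 0) (ursubmx A) (drsubmx A).
Proof.
move=> As; rewrite /bordered_mx -[LHS]submxK; congr block_mx.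
  apply/matrixP => i j; rewrite !ord1 !mxE eqxx mulr1n.
  by congr (A _ _); apply/val_inj.
by rewrite -[in LHS]As; apply/matrixP => i j; rewrite !mxE.
Qed.

End schur.

Section measurable_posdef.
Context {R : realType}.

Lemma measurable_symmetric m : measurable [set A : 'M[R]_m | A^T = A].
Proof.
rewrite (_ : [set _ | _] = \bigcap_(p in [set: 'I_m * 'I_m])
    [set A : 'M[R]_m | (A p.2 p.1 == A p.1 p.2) = true]).
  apply: fin_bigcap_measurable => // p _.
  have mf : measurable_fun setT (fun A : 'M[R]_m => A p.2 p.1 == A p.1 p.2).
    by apply: measurable_fun_eqr; exact: measurable_mx_entry.
  by have := mf measurableT [set true] _; rewrite setTI; exact.
apply/seteqP; split=> A /=.
  by move=> As p _ /=; rewrite -{1}As mxE eqxx.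
by move=> As; apply/matrixP => i j; rewrite mxE; apply/eqP/(As (i, j)).
Qed.

(** The definition quantifies over uncountably many vectors. The Schur complement replaces this by
    symmetry, one inequality, and a measurable preimage of the cone one dimension lower. *)
Lemma measurable_posdefmx m : measurable (@posdefmx R m).
Proof.
elim: m => [|m IH].
  rewrite (_ : posdefmx = setT)//; apply/seteqP; split=> // A _.
  by split=> [|u]; [rewrite thinmx0 [RHS]thinmx0|rewrite thinmx0 eqxx].
pose S (A : 'M[R]_(1 + m)) := schur_mx (A 0 0) (ursubmx A) (drsubmx A).
have mE i j : measurable_fun setT (fun A : 'M[R]_(1 + m) => A i j).
  exact: measurable_mx_entry.
have mS : measurable_fun setT S.
  apply: measurable_fun_addmx.
    by apply/measurable_fun_mxP => i j; under eq_fun do rewrite !mxE; exact: mE.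
  rewrite (_ : (fun _ => _) = fun A : 'M[R]_(1 + m) =>
      (- (A 0 0)^-1) *: ((ursubmx A)^T *m ursubmx A)).
    apply: measurable_fun_scalemx.
      by apply: measurable_funN; apply: (measurableT_comp measurable_invr).
    by apply: measurable_fun_mulmx; apply/measurable_fun_mxP => i j;
      under eq_fun do rewrite !mxE; exact: mE.
  by apply/funext => A; rewrite scaleNr.
rewrite (_ : posdefmx = [set A : 'M[R]_(1 + m) | A^T = A] `&`
   ([set A : 'M[R]_(1 + m) | 0 < A 0 0] `&` S @^-1` posdefmx)).
  apply: measurableI; first exact: measurable_symmetric.
  apply: measurableI; last by rewrite -[X in measurable X]setTI; exact: mS.
  have := mE 0 0 measurableT `]0, +oo[%classic; rewrite setTI.
  rewrite (_ : _ @^-1` _ = [set A : 'M[R]_(1 + m) | 0 < A 0 0]); first exact.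
  by apply/seteqP; split=> A /=; rewrite in_itv/= andbT.
apply/seteqP; split=> A /=.
  move=> Apd; have As := Apd.1.
  move: Apd; rewrite [in posdefmx A](symmetric_mx_bordered As).
  by move=> /posdef_bordered_mx.
move=> [As h]; rewrite (symmetric_mx_bordered As).
exact/posdef_bordered_mx.
Qed.

End measurable_posdef.

(** * Coordinates of the upper triangle *)

Section upper_index_enumeration.
Context {R : realType}.

(** The enumeration is row by row: corner, rest of the first row, then the upper triangle of the
    remaining block. Coordinates therefore split exactly as the bordered decomposition does. *)
Lemma enum_upper_indexS m : enum (@upper_index m.+1) =
  (ord0, ord0) :: [seq (ord0, lift ord0 j) | j <- enum 'I_m] ++
  [seq (lift ord0 p.1, lift ord0 p.2) | p <- enum (@upper_index m)].
Proof.
have enumE k : enum (@upper_index k) =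
    [seq p <- [seq (i, j) | i <- enum 'I_k, j <- enum 'I_k] | upper_index p].
  rewrite {1}/enum_mem unlock /= /prod_enum.
  by apply: eq_filter => p.
rewrite !enumE enum_ordSl /= filter_cat /=.
have -> : [seq p <- [seq (ord0, x) | x <- [seq lift ord0 i | i <- enum 'I_m]] |
    upper_index p] = [seq (ord0, lift ord0 j) | j <- enum 'I_m].
  rewrite -map_comp; apply/all_filterP/allP => p /mapP[j _ ->].
  by [].
congr (_ :: _ ++ _).
have gen (r t : seq 'I_m) :
    [seq p <- [seq (i, j) | i <- [seq lift ord0 i | i <- r],
                            j <- ord0 :: [seq lift ord0 i | i <- t]] |
      upper_index p] =
    [seq (lift ord0 p.1, lift ord0 p.2) |
      p <- [seq p <- [seq (i, j) | i <- r, j <- t] | upper_index p]].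
  elim: r => //= i r IH; rewrite !filter_cat map_cat IH; congr (_ ++ _).
  elim: t {IH} => //= j t IH.
  rewrite [in LHS]/upper_index [in X in _ = _ X]/upper_index /= /bump /= !add1n ltnS.
  by case: ifP => _ /=; rewrite IH.
exact: gen.
Qed.

Lemma card_upper_indexS m : #|@upper_index m.+1| = (1 + (m + #|@upper_index m|))%N.
Proof.
by rewrite cardE enum_upper_indexS -cat1s !size_cat !size_map -?enumT size_enum_ord -cardE.
Qed.

(** A version of [sym_mx] on plain sequences, convertible to it on tuples, so that lists such as
    [x :: v ++ s] need no cast between sizes. *)
Definition sym_mx_seq m (s : seq R) : 'M[R]_m :=
  \matrix_(i, j) nth 0 s
    (index (if (i <= j)%N then (i, j) else (j, i)) (enum (@upper_index m))).

Lemma tr_sym_mx_seq m s : (sym_mx_seq m s)^T = sym_mx_seq m s.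
Proof.
apply/matrixP => i j; rewrite !mxE; congr (nth _ _ (index _ _)).
by case: ltngtP => // /val_inj ->.
Qed.

Lemma sym_mx_seq_cons m x (v s : seq R) : size v = m ->
  sym_mx_seq m.+1 (x :: v ++ s) =
  bordered_mx x (\row_j nth 0 v j) (sym_mx_seq m s).
Proof.
move=> vm.
have iE (i : 'I_m) j : (lift ord0 i, lift ord0 j) \notin
    [seq (ord0, lift ord0 j) | j <- enum 'I_m].
  by apply/mapP => -[k _ [/eqP]].
have upper (i j : 'I_m) : sym_mx_seq m.+1 (x :: v ++ s) (lift ord0 i) (lift ord0 j) =
    sym_mx_seq m s i j.
  rewrite !mxE enum_upper_indexS.
  have -> : (lift ord0 i <= lift ord0 j)%N = (i <= j)%N.
    by rewrite /= /bump /= !add1n ltnS.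
  have idx (p : 'I_m * 'I_m) : index (lift ord0 p.1, lift ord0 p.2)
      [seq (lift ord0 p.1, lift ord0 p.2) | p <- enum (@upper_index m)] =
      index p (enum (@upper_index m)).
    rewrite (_ : (lift ord0 p.1, lift ord0 p.2) =
      (fun p => (lift ord0 p.1, lift ord0 p.2)) p)// index_map//.
    by move=> [a b] [c e] [] /= ac be; congr pair; apply: val_inj.
  have nthE (p : 'I_m * 'I_m) : nth 0 (x :: v ++ s)
      (index (lift ord0 p.1, lift ord0 p.2) ((ord0, ord0) ::
        [seq (ord0, lift ord0 j) | j <- enum 'I_m] ++
        [seq (lift ord0 p.1, lift ord0 p.2) | p <- enum (@upper_index m)])) =
      nth 0 s (index p (enum (@upper_index m))).
    rewrite /= index_cat (negbTE (iE _ _)) size_map -?enumT size_enum_ord /= idx.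
    by rewrite nth_cat vm ltnNge leq_addr /= addKn.
  by case: ifP => _; [exact: (nthE (i, j))|exact: (nthE (j, i))].
have row0 (j : 'I_m) : sym_mx_seq m.+1 (x :: v ++ s) ord0 (lift ord0 j) = nth 0 v j.
  rewrite !mxE enum_upper_indexS /= index_cat.
  have jin : (ord0, lift ord0 j) \in [seq (ord0 : 'I_m.+1, lift ord0 j) | j <- enum 'I_m].
    by apply/mapP; exists j; rewrite ?mem_enum.
  rewrite jin (index_map (f := fun j => (ord0 : 'I_m.+1, lift ord0 j))); last first.
    by move=> a b [] ab; apply: val_inj.
  by rewrite index_enum_ord nth_cat vm ltn_ord.
have lsh0 : lshift m (ord0 : 'I_1) = ord0 :> 'I_m.+1 by apply: val_inj.
have rshE (j : 'I_m) : rshift 1 j = lift ord0 j :> 'I_m.+1 by apply: val_inj.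
apply/matrixP => i j; rewrite /bordered_mx.
case: (@splitP 1 m i) => i' ii; case: (@splitP 1 m j) => j' jj.
- have -> : i = lshift m i' by apply: val_inj.
  have -> : j = lshift m j' by apply: val_inj.
  apply/esym; etransitivity; first exact: block_mxEul.
  rewrite !ord1 mxE eqxx mulr1n lsh0.
  by rewrite !mxE enum_upper_indexS.
- have -> : i = lshift m i' by apply: val_inj.
  have -> : j = rshift 1 j' by apply: val_inj.
  apply/esym; etransitivity; first exact: block_mxEur.
  by rewrite !ord1 lsh0 rshE row0 mxE.
- have -> : i = rshift 1 i' by apply: val_inj.
  have -> : j = lshift m j' by apply: val_inj.
  apply/esym; etransitivity; first exact: block_mxEdl.
  rewrite !ord1 lsh0 rshE -[in RHS]tr_sym_mx_seq [RHS]mxE row0.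
  by rewrite !mxE.
- have -> : i = rshift 1 i' by apply: val_inj.
  have -> : j = rshift 1 j' by apply: val_inj.
  apply/esym; etransitivity; first exact: block_mxEdr.
  by rewrite !rshE upper.
Qed.

Definition upper_coord m (A : 'M[R]_m) : seq R :=
  [seq A p.1 p.2 | p <- enum (@upper_index m)].

Lemma sym_mx_seq_add m (A : 'M[R]_m) s : A^T = A ->
  size s = #|@upper_index m| ->
  sym_mx_seq m (add_seq (upper_coord A) s) = A + sym_mx_seq m s.
Proof.
move=> As sm; apply/matrixP => i j; rewrite !mxE nth_add_seq; last first.
  by rewrite sm size_map cardE.
congr (_ + _); set p := (X in index X _).
have pin : p \in enum (@upper_index m).
  rewrite mem_enum /p unfold_in /=; case: ifP => //=.
  by move=> /negbT; rewrite -ltnNge => /ltnW.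
rewrite (nth_map p) ?index_mem// nth_index// /p.
by case: ifP => _ //=; rewrite -[in LHS]As mxE.
Qed.

Lemma measurable_sym_mx_seq m : measurable_fun setT
  (fun v : #|@upper_index m|.-tuple (measurableTypeR R) => sym_mx_seq m (val v)).
Proof.
apply/measurable_fun_mxP => i j; under eq_fun do rewrite mxE.
set k := index _ _; have [km|km] := ltnP k #|@upper_index m|.
  rewrite (_ : (fun _ => _) =
    fun v : #|@upper_index m|.-tuple (measurableTypeR R) => tnth v (Ordinal km)).
    exact: measurable_tnth.
  by apply/funext => v; rewrite (tnth_nth 0).
rewrite (_ : (fun _ => _) = cst 0); first exact: measurable_cst.
by apply/funext => v; rewrite nth_default// size_tuple.
Qed.

End upper_index_enumeration.

(** * The determinant of a Wishart matrix *)

Section wishart_recursion.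
Context {R : realType}.
Local Notation mu := (@lebesgue_measure R).
Implicit Types (p x : R) (phi : R -> R).

(** Obtained from the unit mass of the normal density with variance [x]. The factor [Num.sqrt x] is
    written as an exponential so that it merges with the exponent of the pivot. *)
Lemma gaussian_integral x : 0 < x ->
  (\int[mu]_y (expR (- (y ^+ 2 / (2 * x))))%:E)%E =
  (Num.sqrt (2 * pi) * expR (ln x / 2))%:E.
Proof.
move=> x0; pose s := Num.sqrt x.
have s0 : s != 0 by rewrite gt_eqF// sqrtr_gt0.
have s2 : s ^+ 2 = x by rewrite sqr_sqrtr// ltW.
have peak0 := normal_peak_gt0 s0.
have mg : measurable_fun setT (fun y : R => expR (- (y ^+ 2 / (2 * x)))).
  by measurability.
have : ((normal_peak s)%:E * \int[mu]_y (expR (- (y ^+ 2 / (2 * x))))%:E = 1)%E.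
  rewrite -ge0_integralZl//; last 2 first.
  - exact/measurable_EFinP.
  - by rewrite lee_fin ltW.
  rewrite -[RHS](integral_normal_pdf 0 s); apply: eq_integral => y _.
  rewrite normal_pdfE// -EFinM /normal_fun subr0 s2 mulNr; congr (_ * expR (- (_ / _)))%:E.
  by rewrite mulr_natl.
move=> h; have e0 : expR (ln x / 2) = s.
  have lx : ln x = 2%:R * (ln x / 2) by field.
  rewrite /s -[in RHS](lnK x0) [in RHS]lx.
  by rewrite expRM_natl sqrtr_sqr ger0_norm ?expR_ge0.
have -> : Num.sqrt (2 * pi) * expR (ln x / 2) = (normal_peak s)^-1.
  rewrite e0 /normal_peak invrK s2 (_ : x * pi *+ 2 = (2 * pi) * x); last by ring.
  by rewrite [RHS]sqrtrM// mulr_ge0// pi_ge0.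
rewrite -[LHS]mul1e -(_ : (normal_peak s)^-1%:E * (normal_peak s)%:E = 1)%E.
  by rewrite -muleA h mule1.
by rewrite -EFinM mulVf// gt_eqF.
Qed.

(* For [p = a - (m + 1) / 2], the unnormalized Wishart density times a test
   function of the log-determinant. *)
Definition wishart_fun m p phi (A : 'M[R]_m) : R :=
  `[< posdefmx A >]%:R *
    (expR (p * ln (\det A) - \tr A / 2) * phi (ln (\det A))).

Definition wishart_int m p phi : \bar R :=
  lebesgue_seq #|@upper_index m|
    (fun s => (wishart_fun p phi (sym_mx_seq m s))%:E).

Lemma wishart_fun_ge0 m p phi (A : 'M[R]_m) : (forall u, 0 <= phi u) ->
  0 <= wishart_fun p phi A.
Proof. by move=> phi0; rewrite !mulr_ge0// expR_ge0. Qed.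

Lemma wishart_int_ge0 m p phi : (forall u, 0 <= phi u) ->
  (0 <= wishart_int m p phi)%E.
Proof.
by move=> phi0; apply: lebesgue_seq_ge0 => s; rewrite lee_fin wishart_fun_ge0.
Qed.

Lemma wishart_funE m p phi (A : 'M[R]_m) :
  wishart_fun p phi A = wishart_fun p (fun=> 1) A * phi (ln (\det A)).
Proof. by rewrite /wishart_fun mulr1 mulrA. Qed.

Lemma measurable_wishart_fun m p phi : measurable_fun setT phi ->
  measurable_fun setT (@wishart_fun m p phi).
Proof.
move=> mphi.
have mln : measurable_fun setT (fun A : 'M[R]_m => ln (\det A)).
  by apply: measurable_fun_ln; apply: measurable_fun_det; exact: measurable_id.
apply: measurable_funM.
  apply: measurable_fun_boolr; apply: (@measurable_fun_bool _ _ _ _ true).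
  rewrite setTI (_ : _ @^-1` _ = posdefmx); first exact: measurable_posdefmx.
  by apply/seteqP; split=> A /= /asboolP.
apply: measurable_funM; last exact: (measurableT_comp mphi mln).
apply: measurable_fun_expR; apply: measurable_funB.
  exact: measurable_funM.
apply: measurable_funM => //; apply: measurable_fun_mxtrace.
exact: measurable_id.
Qed.

Lemma seq_measurable_wishart m p phi : measurable_fun setT phi ->
  seq_measurable #|@upper_index m|
    (fun s => (wishart_fun p phi (sym_mx_seq m s))%:E).
Proof.
move=> /(@measurable_wishart_fun m p) mw; apply/measurable_EFinP.
exact: (measurableT_comp mw (@measurable_sym_mx_seq R m)).
Qed.

(** The determinant factors and the trace splits, which separates the pivot, the first row and the
    Schur complement. The last keeps the same [p], whereas the Wishart parameter [a] would change
    with the dimension. *)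
Lemma wishart_fun_bordered m p phi x (r : 'rV[R]_m) (Y : 'M[R]_m) : 0 < x ->
  wishart_fun p phi (bordered_mx x r Y) =
  expR (p * ln x - x / 2) * (\prod_i expR (- (r 0 i ^+ 2 / (2 * x)))) *
  wishart_fun p (fun u => phi (u + ln x)) (schur_mx x r Y).
Proof.
move=> x0; rewrite /wishart_fun.
have -> : `[< posdefmx (bordered_mx x r Y) >] = `[< posdefmx (schur_mx x r Y) >].
  by apply: asbool_equiv_eq; rewrite posdef_bordered_mx; split=> [[]|].
case: asboolP => [pd|_]; last by rewrite !mul0r mulr0.
rewrite !mul1r det_bordered_mx ?gt_eqF// lnM ?posrE ?posdef_det_gt0//.
rewrite tr_bordered_mx mulrA; congr (_ * _); last by rewrite addrC.
rewrite -expR_sum -!expRD; congr expR.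
rewrite sumrN -mulr_suml; field.
by rewrite gt_eqF.
Qed.

Lemma wishart_fun_bordered_le0 m p phi x (r : 'rV[R]_m) (Y : 'M[R]_m) :
  x <= 0 -> wishart_fun p phi (bordered_mx x r Y) = 0.
Proof.
move=> x0; rewrite /wishart_fun; case: asboolP => [|_]; last by rewrite mul0r.
by move=> /posdef_bordered_mx[]; rewrite ltNge x0.
Qed.

Lemma measurable_wishart_int_shift m p phi : (forall u, 0 <= phi u) ->
  measurable_fun setT phi ->
  measurable_fun setT (fun x => wishart_int m p (fun u => phi (u + ln x))).
Proof.
move=> phi0 mphi.
apply: (measurable_lebesgue_seq (g := fun x s =>
  (wishart_fun p (fun u => phi (u + ln x)) (sym_mx_seq m s))%:E)).
  by move=> x s; rewrite lee_fin wishart_fun_ge0.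
apply/measurable_EFinP; under eq_fun do rewrite wishart_funE.
have msnd : measurable_fun setT (fun z : measurableTypeR R *
    #|@upper_index m|.-tuple (measurableTypeR R) => sym_mx_seq m (val z.2)).
  by apply: (measurableT_comp (@measurable_sym_mx_seq R m)); exact: measurable_snd.
apply: measurable_funM.
  by apply: measurableT_comp msnd; apply: measurable_wishart_fun.
apply: (measurableT_comp mphi); apply: measurable_funD.
  by apply: measurable_fun_ln; exact: measurable_fun_det.
by apply: measurable_fun_ln; exact: measurable_fst.
Qed.

(* Pivoting on the first entry [x]: translating the Schur complement separates
   the other entries of the first row, which integrate to [(2 pi x)^(m/2)]. *)
Lemma wishart_intS m p phi : (forall u, 0 <= phi u) ->
  measurable_fun setT phi ->
  (wishart_int m.+1 p phi = (Num.sqrt (2 * pi) ^+ m)%:E *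
   \int[mu]_x ((pivot_ker p m%:R x)%:E *
     wishart_int m p (fun u => phi (u + ln x)%R)))%E.
Proof.
move=> phi0 mphi; pose N := #|@upper_index m|.
have mphix x : measurable_fun setT (fun u : R => phi (u + ln x)).
  by apply: (measurableT_comp mphi); exact: measurable_funD.
pose f s := (wishart_fun p phi (sym_mx_seq m.+1 s))%:E.
have f0 s : (0 <= f s)%E by rewrite lee_fin wishart_fun_ge0.
have mf : seq_measurable (m + N).+1 f.
  by have := @seq_measurable_wishart m.+1 p _ mphi; rewrite card_upper_indexS.
have sq0 : 0 <= Num.sqrt (2 * pi) ^+ m :> R by rewrite exprn_ge0// sqrtr_ge0.
rewrite /wishart_int card_upper_indexS add1n -/f -/N lebesgue_seqS//.
rewrite -ge0_integralZl//; last 2 first.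
- apply: emeasurable_funM; first by apply/measurable_EFinP; exact: measurable_pivot_ker.
  exact: measurable_wishart_int_shift.
- by move=> x _; rewrite mule_ge0 ?lee_fin ?pivot_ker_ge0//;
    apply: lebesgue_seq_ge0 => s; rewrite lee_fin wishart_fun_ge0.
apply: eq_integral => x _.
rewrite lebesgue_seqD//; last exact: seq_measurable_cons.
have [x0|x0] := leP x 0.
  have -> : pivot_ker p m%:R x = 0 by rewrite /pivot_ker ltNge x0 mul0r.
  rewrite mul0e mule0.
  transitivity (lebesgue_seq m (fun=> 0%E) : \bar R); last exact: integral0.
  apply: eq_lebesgue_seq => v vm.
  transitivity (lebesgue_seq N (fun=> 0%E) : \bar R); last exact: integral0.
  apply: eq_lebesgue_seq => s _.
  by rewrite /f sym_mx_seq_cons// wishart_fun_bordered_le0.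
pose phix u := phi (u + ln x); pose W := wishart_int m p phix.
have phix0 u : 0 <= phix u by exact: phi0.
have W0 : (0 <= W)%E by exact: wishart_int_ge0.
pose E := expR (p * ln x - x / 2).
pose h y : R := expR (- (y ^+ 2 / (2 * x))).
have mh : measurable_fun setT h.
  by measurability.
have h0 y : 0 <= h y by exact: expR_ge0.
pose c (v : seq R) : \bar R := (\prod_(y <- v) h y)%:E.
have c0 v : (0 <= c v)%E by rewrite lee_fin prodr_ge0.
transitivity (lebesgue_seq m (fun v => E%:E * W * c v)%E).
  apply: eq_lebesgue_seq => v vm.
  pose r : 'rV[R]_m := \row_j nth 0 v j.
  pose A : 'M[R]_m := - (x^-1 *: (r^T *m r)).
  have As : A^T = A by rewrite /A linearN /= linearZ /= trmx_mul trmxK.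
  pose g s := (wishart_fun p phix (sym_mx_seq m s))%:E.
  have g0 s : (0 <= g s)%E by rewrite lee_fin wishart_fun_ge0.
  have mg : seq_measurable N g by apply: seq_measurable_wishart; exact: mphix.
  have tN : size (upper_coord A) = N by rewrite size_map /N cardE.
  transitivity (lebesgue_seq N
      (fun s => (E%:E * c v) * g (add_seq (upper_coord A) s)))%E.
    apply: eq_lebesgue_seq => s sN.
    rewrite /f /g sym_mx_seq_cons// wishart_fun_bordered// sym_mx_seq_add//.
    rewrite [A + _]addrC -/(schur_mx x r _) /c -!EFinM; congr (_ * _ * _)%:E.
    rewrite (big_nth 0) vm big_mkord; apply: eq_bigr => i _.
    by rewrite mxE.
  rewrite lebesgue_seqZl//; last 2 first.
  - exact: seq_measurable_add_seq.
  - by rewrite mule_ge0// lee_fin expR_ge0.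
  by rewrite lebesgue_seq_translation// -/W muleAC.
rewrite lebesgue_seqZl//; last 2 first.
- exact: seq_measurable_prod.
- by rewrite mule_ge0// lee_fin expR_ge0.
rewrite lebesgue_seq_prod// gaussian_integral// -EFin_expe exprMn.
rewrite muleAC -EFinM [RHS]muleA -EFinM; congr (_%:E * _)%E.
rewrite mulrCA; congr (_ * _); rewrite /pivot_ker x0 mul1r /E.
rewrite -expRM_natl -expRD; congr expR; by field.
Qed.

End wishart_recursion.

Section domination_step.
Context {R : realType}.
Local Notation mu := (@lebesgue_measure R).
Local Open Scope ereal_scope.
Variables (q W H : R -> \bar R) (K K1 T h1 C : \bar R).
Hypotheses (q0 : forall x, 0 <= q x) (W0 : forall x, 0 <= W x)
  (H0 : forall x, 0 <= H x) (K10 : 0 <= K1) (T0 : 0 <= T) (C0 : 0 <= C).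
Hypotheses (mq : measurable_fun setT q) (mW : measurable_fun setT W)
  (mH : measurable_fun setT H).
Hypotheses (Kfin : K \is a fin_num) (Kpos : 0 < K).

(** The two comparisons are chained by multiplying through by [K], the mass of the intermediate law,
    and cancelling it at the end; this is where [K] must be positive and finite. *)
Lemma domination_step : (forall x, W x * K <= H x * T) ->
  \int[mu]_x (q x * H x) * K1 <= h1 * \int[mu]_x (q x * K) ->
  C * \int[mu]_x (q x * W x) * K1 <= h1 * (C * \int[mu]_x (q x * T)).
Proof.
move=> WH dom; have K0 := ltW Kpos.
have qW0 x : 0 <= q x * W x by rewrite mule_ge0.
have qH0 x : 0 <= q x * H x by rewrite mule_ge0.
have mqW : measurable_fun setT (fun x => q x * W x) by exact: emeasurable_funM.
have mqH : measurable_fun setT (fun x => q x * H x) by exact: emeasurable_funM.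
have intZ (Z : \bar R) : 0 <= Z -> \int[mu]_x (q x * Z) = Z * \int[mu]_x q x.
  move=> Z0; rewrite -ge0_integralZl//.
  by apply: eq_integral => x _; rewrite muleC.
rewrite (intZ _ K0) in dom; rewrite (intZ _ T0).
have step : \int[mu]_x (q x * W x) * K <= \int[mu]_x (q x * H x) * T.
  rewrite muleC [leRHS]muleC -(ge0_integralZl mu measurableT mqW (fun x _ => qW0 x) K0).
  rewrite -(ge0_integralZl mu measurableT mqH (fun x _ => qH0 x) T0).
  apply: ge0_le_integral => //.
  - by move=> x _; rewrite mule_ge0.
  - exact: emeasurable_funM.
  - exact: emeasurable_funM.
  - move=> x _; rewrite muleCA [leRHS]muleCA lee_wpmul2l//.
    by rewrite muleC [leRHS]muleC.
rewrite -(lee_pmul2r Kfin Kpos).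
move: (\int[mu]_x (q x * W x)) (\int[mu]_x (q x * H x)) (\int[mu]_x q x) step dom.
move=> IW IH G step dom.
have -> : C * IW * K1 * K = C * K1 * (IW * K).
  by rewrite muleA; congr (_ * _); rewrite muleAC.
apply: (@le_trans _ _ (C * K1 * (IH * T))).
  by rewrite lee_wpmul2l// mule_ge0.
have -> : C * K1 * (IH * T) = C * T * (IH * K1).
  by rewrite -!muleA; congr (_ * _); rewrite muleC -muleA muleCA muleA muleC.
have -> : h1 * (C * (T * G)) * K = C * T * (h1 * (K * G)).
  rewrite muleCA -!muleA; congr (_ * _); rewrite muleCA; congr (_ * _).
  by rewrite [K * G]muleC.
by rewrite lee_wpmul2l// mule_ge0.
Qed.

End domination_step.

Section wishart_domination.
Context {R : realType}.
Local Notation mu := (@lebesgue_measure R).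
Implicit Types (p c x : R) (phi : R -> R).

Let le_ind c u : R := (u <= c)%R%:R.

Let le_ind_ge0 c u : 0 <= le_ind c u. Proof. by []. Qed.

Let measurable_le_ind c : measurable_fun setT (le_ind c).
Proof. by rewrite /le_ind; measurability. Qed.

Lemma wishart_int0 p phi : (forall u, 0 <= phi u) ->
  wishart_int 0 p phi = (phi 0)%:E.
Proof.
move=> phi0; rewrite /wishart_int eq_card0; last by case=> -[].
rewrite lebesgue_seq0; last by move=> s; rewrite lee_fin wishart_fun_ge0.
rewrite /wishart_fun det_mx00 ln1 mulr0 /mxtrace big_ord0 mul0r subr0 expR0 mul1r.
rewrite (_ : `[< _ >] = true) ?mul1r//; apply/asboolP.
by split=> [|u]; [rewrite thinmx0 [RHS]thinmx0|rewrite thinmx0 eqxx].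
Qed.

Lemma wishart_int1 p phi : (forall u, 0 <= phi u) -> measurable_fun setT phi ->
  (wishart_int 1 p phi =
   \int[mu]_(x in `]0%R, +oo[) (expR (p * ln x - x / 2) * phi (ln x))%:E)%E.
Proof.
move=> phi0 mphi; rewrite wishart_intS// expr0 mul1e [RHS]integral_mkcond.
apply: eq_integral => x _; rewrite wishart_int0// add0r patchE /pivot_ker.
rewrite mul0r addr0; case: ifPn; rewrite ?inE ?notin_setE/= in_itv/= andbT.
  by move=> ->; rewrite mul1r EFinM.
by move=> /negP/negbTE ->; rewrite mul0r mul0e.
Qed.

(** In the variable [u = ln x] the Jacobian leaves the factor [expR u] over [loggamma_ker p 1]: the
    pivot has exponent [p], while a chi-squared variable with [2 * p] degrees of freedom has
    [p - 1]. This factor is nondecreasing, which starts the induction. *)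
Let wishart_int1E p :
  (wishart_int 1 p (fun=> 1%R) =
   \int[mu]_u ((loggamma_ker p 1 u)%:E * (expR u)%:E))%E /\
  forall c, (wishart_int 1 p (le_ind c) =
   \int[mu]_u ((le_ind c u * loggamma_ker p 1 u)%:E * (expR u)%:E))%E.
Proof.
have E u : expR ((p + 1) / 1 * u - 1 / 2 * expR (u / 1)) =
    loggamma_ker p 1 u * expR u.
  by rewrite /loggamma_ker -expRD; congr expR; field.
split=> [|c].
  rewrite wishart_int1//; under eq_integral do rewrite mulr1.
  rewrite (gamma_mass_substitution p ltr01) ln1 mulr0 expR0 mul1e.
  by apply: eq_integral => u _; rewrite E EFinM.
rewrite wishart_int1//.
transitivity (\int[mu]_(x in `]0%R, (1 * expR (c / 1))%R]) (expR (p * ln x - x / 2))%:E)%E.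
  rewrite [LHS]integral_mkcond [RHS]integral_mkcond; apply: eq_integral => x _.
  rewrite !patchE; case: ifPn; rewrite ?inE ?notin_setE/= in_itv/= andbT.
    move=> x0; rewrite /le_ind -[x in (x <= c)%R]/(ln x).
    have -> : (ln x <= c) = (x <= 1 * expR (c / 1)).
      by rewrite divr1 mul1r -[in RHS](lnK x0) ler_expR.
    case: ifPn; rewrite ?inE ?notin_setE/= in_itv/= x0/=.
      by move=> ->; rewrite mulr1.
    by move=> /negP/negbTE ->; rewrite mulr0.
  move=> /negP/negbTE x0; case: ifPn => //.
  by rewrite inE/= in_itv/= x0.
rewrite (gamma_cdf_substitution p ltr01) ln1 mulr0 expR0 mul1e.
by apply: eq_integral => u _; rewrite E -EFinM mulrA.
Qed.

Let measurable_loggamma_int_shift p k c :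
  measurable_fun setT (fun x => loggamma_int p k (fun u => le_ind c (u + ln x))).
Proof.
apply: (@measurable_fun_fubini_tonelli_F _ _ (measurableTypeR R)
  (measurableTypeR R) _ mu
  (fun z => (le_ind c (z.2 + ln z.1) * loggamma_ker p k z.2)%:E)).
- by apply/measurable_EFinP; rewrite /loggamma_ker /le_ind; measurability.
- by move=> z; rewrite lee_fin mulr_ge0// loggamma_ker_ge0.
Qed.

(** Induction on the size. The Schur complement is first replaced by the log-gamma variable of stage
    [m], for each value of the pivot, and then the pivot is absorbed into stage [m + 1]. *)
Lemma wishart_domination m p c : 0 < p ->
  (loggamma_int p m.+1%:R (fun=> 1%R) < +oo)%E ->
  (wishart_int m.+1 p (fun u => (u <= c)%R%:R) *
     loggamma_int p m.+1%:R (fun=> 1%R) <=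
   loggamma_int p m.+1%:R (fun u => (u <= c)%R%:R) *
     wishart_int m.+1 p (fun=> 1%R))%E.
Proof.
move=> p0; rewrite -/(le_ind c); elim: m c => [|m IH] c fin.
  have [-> ->] := wishart_int1E p.
  have -> : loggamma_int p 1 (fun=> 1%R) = (\int[mu]_u (loggamma_ker p 1 u)%:E)%E.
    by apply: eq_integral => u _; rewrite mul1r.
  apply: integral_le_nondecreasing.
  - exact: measurable_loggamma_ker.
  - by move=> x; exact: loggamma_ker_ge0.
  - exact/measurable_EFinP.
  - by move=> x; rewrite lee_fin expR_ge0.
  - by move=> x y xy; rewrite lee_fin ler_expR.
pose k : R := m.+1%:R; have k0 : 0 < k by rewrite ltr0n.
have kE : m.+2%:R = k + 1 by rewrite natr1.
rewrite kE in fin *.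
have kfin := loggamma_mass_fin k0 fin.
have kpos := loggamma_mass_gt0 p0 k0.
have {}IH c' := IH c' kfin.
have one0 : forall u : R, 0 <= (fun=> 1) u by [].
have mone : measurable_fun setT (fun _ : R => 1 : R) by exact: measurable_cst.
pose K := loggamma_int p k (fun=> 1%R).
pose T := wishart_int m.+1 p (fun=> 1%R).
have T0 : (0 <= T)%E by exact: wishart_int_ge0.
have K0 : (0 <= K)%E by exact: ltW.
have Kfin : K \is a fin_num by rewrite ge0_fin_numE.
pose W x := wishart_int m.+1 p (fun u => le_ind c (u + ln x)).
pose H x := loggamma_int p k (fun u => le_ind c (u + ln x)).
(* Given the pivot [x], the induction hypothesis is applied at the level [c - ln x]. *)
have WH x : (W x * K <= H x * T)%E.
  have := IH (c - ln x); rewrite /W /H.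
  have -> : (fun u => le_ind c (u + ln x)) = le_ind (c - ln x).
    by apply/funext => u; rewrite /le_ind lerBrDr.
  exact.
have W0 x : (0 <= W x)%E by exact: wishart_int_ge0.
have H0 x : (0 <= H x)%E by exact: loggamma_int_ge0.
have mW : measurable_fun setT W.
  by apply: (@measurable_wishart_int_shift _ _ _ (le_ind c)).
have mH : measurable_fun setT H by exact: measurable_loggamma_int_shift.
pose q x := pivot_ker p k x.
have q0 x : (0 <= (q x)%:E)%E by rewrite lee_fin pivot_ker_ge0.
have mq : measurable_fun setT (EFin \o q).
  by apply/measurable_EFinP; exact: measurable_pivot_ker.
have dom := pivot_loggamma_domination p c k0; rewrite -/K -/(le_ind c) in dom.
rewrite (wishart_intS _ p (phi := le_ind c))// (wishart_intS _ p (phi := fun=> 1))//.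
rewrite -/k -/T.
have C0 : (0 <= (Num.sqrt (2 * pi) ^+ m.+1 : R)%:E)%E.
  by rewrite lee_fin exprn_ge0// sqrtr_ge0.
have K10 : (0 <= loggamma_int p (k + 1) (fun=> 1%R))%E by exact: loggamma_int_ge0.
exact: (domination_step q0 W0 H0 K10 T0 C0 mq mW mH Kfin kpos WH dom).
Qed.

End wishart_domination.

(** * Stochastic domination of sums *)

Section convolution.
Context {R : realType}.
Local Open Scope ereal_scope.

Lemma measurable_le_set d (T : measurableType d) (f : T -> R) (c : R) :
  measurable_fun setT f -> measurable [set t | (f t <= c)%R].
Proof.
move=> mf; have mfc : measurable_fun setT (fun t => (f t <= c)%R).
  exact: measurable_fun_ler.
by have := mfc measurableT [set true] _; rewrite setTI; exact.
Qed.

Let half_plane (c : R) : set (R * R) := [set z | (z.1 + z.2 <= c)%R].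

Let measurable_half_plane c : measurable (half_plane c).
Proof.
apply: measurable_le_set.
by apply: measurable_funD; [exact: measurable_fst|exact: measurable_snd].
Qed.

Let xsection_half_plane c x : xsection (half_plane c) x = [set y | (x + y <= c)%R].
Proof. by apply/seteqP; split=> y; rewrite /xsection /= inE. Qed.

Let ysection_half_plane c y : ysection (half_plane c) y = [set x | (x + y <= c)%R].
Proof. by apply/seteqP; split=> x; rewrite /ysection /= inE. Qed.

Variables m1 m2 : probability R R.

Lemma product_half_plane c :
  (m1 \x m2) [set z : R * R | (z.1 + z.2 <= c)%R] =
  \int[m1]_x m2 [set y | (x + y <= c)%R].
Proof. by apply: eq_integral => x _; rewrite /= xsection_half_plane. Qed.

Lemma convolution_cdfC c :
  \int[m1]_x m2 [set y | (x + y <= c)%R] = \int[m2]_y m1 [set x | (x + y <= c)%R].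
Proof.
rewrite -product_half_plane -/(half_plane c); transitivity ((m1 \x^ m2) (half_plane c)).
  apply: (product_measure_unique _ (measurable_half_plane c)) => A B mA mB.
  exact: product_measure2E.
by apply: eq_integral => x _; rewrite /= ysection_half_plane.
Qed.

Lemma measurable_convolution_cdf c :
  measurable_fun setT (fun x : R => m2 [set y | (x + y <= c)%R]).
Proof.
rewrite (_ : (fun x => _) = m2 \o xsection (half_plane c)).
  by apply: measurable_fun_xsection; exact: measurable_half_plane.
by apply/funext => x; rewrite /= xsection_half_plane.
Qed.

Lemma measurable_convolution_cdfC c :
  measurable_fun setT (fun y : R => m1 [set x | (x + y <= c)%R]).
Proof.
rewrite (_ : (fun x => _) = m1 \o ysection (half_plane c)).
  by apply: measurable_fun_ysection; exact: measurable_half_plane.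
by apply/funext => y; rewrite /= ysection_half_plane.
Qed.

End convolution.

Section independent_pair.
Context {d : measure_display} {T : measurableType d} {R : realType}
  (P : probability T R).
Variables X Y : {mfun T >-> R}.
Local Open Scope ereal_scope.
Local Notation pair_law := (distribution P X \x distribution P Y).

Let XY (t : T) : R * R := (X t, Y t).

Let mXY : measurable_fun setT XY.
Proof. exact: measurable_fun_pair. Qed.

Let mpre d' (T' : measurableType d') (f : T -> T') E : measurable_fun setT f ->
  measurable E -> measurable (f @^-1` E).
Proof. by move=> mf mE; rewrite -[X in measurable X]setTI; exact: mf. Qed.

(* Dividing by [P D] turns the trace on [D] of the joint law into a measure with
   the rectangle values that characterize the product measure. *)
Lemma independent_pair_law (D : set T) : measurable D ->
  (forall A B, measurable A -> measurable B ->
    P (X @^-1` A `&` (Y @^-1` B `&` D)) =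
    P (X @^-1` A) * (P (Y @^-1` B) * P D)) ->
  forall E : set (R * R), measurable E ->
  P ((fun t => (X t, Y t)) @^-1` E `&` D) = pair_law E * P D.
Proof.
move=> mD indep E mE; rewrite -/XY.
have PDfin : P D \is a fin_num by exact: fin_num_measure.
have [PD0|PD0] := eqVneq (P D) 0.
  rewrite PD0 mule0; apply/eqP; rewrite eq_le measure_ge0 andbT -PD0.
  by apply: le_measure; rewrite ?inE//; apply: measurableI => //; exact: mpre.
have r0 : (0 <= (fine (P D))^-1)%R by rewrite invr_ge0 fine_ge0.
pose m' := mscale (NngNum r0) (pushforward (mrestr P mD) XY).
have rPD : (fine (P D))^-1%:E * P D = 1.
  rewrite -{2}(fineK PDfin) -EFinM mulVf//.
  by apply: contra PD0 => /eqP h; rewrite -(fineK PDfin) h.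
have -> : pair_law E = m' mXY E.
  apply: product_measure_unique => // A B mA mB.
  rewrite -[LHS]/((fine (P D))^-1%:E * P (XY @^-1` (A `*` B) `&` D)).
  rewrite (_ : XY @^-1` (A `*` B) `&` D = X @^-1` A `&` (Y @^-1` B `&` D)).
    rewrite indep// muleCA -[RHS]mule1 -rPD /distribution /pushforward -!muleA.
    by congr (_ * _); rewrite muleCA.
  by apply/seteqP; split=> t /= [] => [[]|? []].
rewrite -[m' mXY E]/((fine (P D))^-1%:E * P (XY @^-1` E `&` D)).
by rewrite muleAC rPD mul1e.
Qed.

End independent_pair.

Section independent_sums.
Context {d : measure_display} {T : measurableType d} {R : realType}
  (P : probability T R).
Variables (n : nat) (a : nat -> {mfun T >-> R}).
Local Open Scope ereal_scope.

Definition partial_sum k : {mfun T >-> R} := (\sum_(i < k) a i)%R.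

Lemma partial_sumS k t : partial_sum k.+1 t = (partial_sum k t + a k t)%R.
Proof. by rewrite /partial_sum big_ord_recr. Qed.

Lemma partial_sum0 t : partial_sum 0 t = 0%R.
Proof. by rewrite /partial_sum big_ord0. Qed.

Hypothesis indep : forall C : nat -> set R, (forall i, measurable (C i)) ->
  P (\bigcap_(i < n) (a i @^-1` C i)) = \prod_(i < n) P (a i @^-1` C i).

Let mpre (f : {mfun T >-> R}) E : measurable E -> measurable (f @^-1` E).
Proof. by move=> mE; rewrite -[X in measurable X]setTI; exact: measurable_funP. Qed.

Let tail k (C : nat -> set R) : set T :=
  \bigcap_(i in [set i | (k <= i < n)%N]) (a i @^-1` C i).

Let mtail k C : (forall i, measurable (C i)) -> measurable (tail k C).
Proof.
move=> mC; apply: fin_bigcap_measurable => [|i _]; last exact: mpre.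
by apply: (sub_finite_set (B := `I_n)) => // i /= /andP[].
Qed.

Let tailS k C : (k < n)%N -> tail k C = (a k @^-1` C k) `&` tail k.+1 C.
Proof.
move=> kn; apply/seteqP; split=> t /=.
  move=> h; split; first by apply: h; rewrite /= leqnn.
  by move=> i /= /andP[ki ni]; apply: h; rewrite /= ltnW.
move=> [hk h] i /= /andP[]; rewrite leq_eqVlt => /predU1P[<-//|ki ni].
by apply: h; rewrite /= ki.
Qed.

Let pair_law_tail k : (k < n)%N ->
  (forall B C, measurable B -> (forall i, measurable (C i)) ->
    P (partial_sum k @^-1` B `&` tail k C) =
    P (partial_sum k @^-1` B) * \prod_(k <= i < n) P (a i @^-1` C i)) ->
  forall C E, (forall i, measurable (C i)) -> measurable E ->
  P ((fun t => (partial_sum k t, a k t)) @^-1` E `&` tail k.+1 C) =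
  (distribution P (partial_sum k) \x distribution P (a k)) E *
    \prod_(k.+1 <= i < n) P (a i @^-1` C i).
Proof.
move=> kn IH C E mC mE.
have PE A B : measurable A -> measurable B ->
    P (partial_sum k @^-1` A `&` (a k @^-1` B `&` tail k.+1 C)) =
    P (partial_sum k @^-1` A) *
      (P (a k @^-1` B) * \prod_(k.+1 <= i < n) P (a i @^-1` C i)).
  move=> mA mB; pose C' i := if i == k then B else C i.
  have mC' i : measurable (C' i) by rewrite /C'; case: ifP.
  have := IH A C' mA mC'; rewrite tailS// big_ltn// /C' eqxx.
  have -> : tail k.+1 (fun i => if i == k then B else C i) = tail k.+1 C.
    apply: eq_bigcapr => i /= /andP[ki _].
    by rewrite gtn_eqF.
  move=> ->; congr (_ * (_ * _)).
  by apply: eq_big_nat => i /andP[ki _]; rewrite gtn_eqF.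
have PT : P (tail k.+1 C) = \prod_(k.+1 <= i < n) P (a i @^-1` C i).
  have := PE _ _ measurableT measurableT.
  by rewrite !preimage_setT !setTI probability_setT !mul1e.
rewrite independent_pair_law ?PT//; exact: mtail.
Qed.

Let pair_law k : (k < n)%N ->
  (forall B C, measurable B -> (forall i, measurable (C i)) ->
    P (partial_sum k @^-1` B `&` tail k C) =
    P (partial_sum k @^-1` B) * \prod_(k <= i < n) P (a i @^-1` C i)) ->
  forall E : set (R * R), measurable E ->
  P ((fun t => (partial_sum k t, a k t)) @^-1` E) =
  (distribution P (partial_sum k) \x distribution P (a k)) E.
Proof.
move=> kn IH E mE.
have := pair_law_tail kn IH (fun=> measurableT) mE.
have -> : tail k.+1 (fun=> setT) = setT by apply: bigcapT.
rewrite setIT => ->.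
under eq_bigr do rewrite preimage_setT probability_setT.
by rewrite big1 ?mule1.
Qed.

(** The induction carries arbitrary events on all later variables along with the partial sum;
    independence from the next summand alone would not propagate to the following step. *)
Let tail_indep k : (k <= n)%N -> forall B C, measurable B ->
  (forall i, measurable (C i)) ->
  P (partial_sum k @^-1` B `&` tail k C) =
  P (partial_sum k @^-1` B) * \prod_(k <= i < n) P (a i @^-1` C i).
Proof.
elim: k => [|k IH] kn B C mB mC.
  have -> : tail 0 C = \bigcap_(i < n) (a i @^-1` C i) by [].
  have [B0|B0] := pselect (B 0%R).
    have -> : partial_sum 0 @^-1` B = setT.
      by apply/seteqP; split=> // t _ /=; rewrite partial_sum0.
    by rewrite setTI indep// probability_setT mul1e big_mkord.
  have -> : partial_sum 0 @^-1` B = set0.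
    by apply/seteqP; split=> // t /=; rewrite partial_sum0.
  by rewrite set0I measure0 mul0e.
have {}IH := IH (ltnW kn).
pose E := [set z : R * R | B (z.1 + z.2)%R].
have mE : measurable E.
  have mf : measurable_fun setT (fun z : R * R => (z.1 + z.2)%R).
    by apply: measurable_funD; [exact: measurable_fst|exact: measurable_snd].
  by have := mf measurableT _ mB; rewrite setTI.
have SE : partial_sum k.+1 @^-1` B = (fun t => (partial_sum k t, a k t)) @^-1` E.
  by apply/seteqP; split=> t; rewrite /E /= partial_sumS.
by rewrite SE pair_law_tail// pair_law.
Qed.

Lemma partial_sum_pair_law k : (k < n)%N -> forall E : set (R * R), measurable E ->
  P ((fun t => (partial_sum k t, a k t)) @^-1` E) =
  (distribution P (partial_sum k) \x distribution P (a k)) E.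
Proof. by move=> kn; apply: pair_law => //; exact: tail_indep (ltnW kn). Qed.

Lemma partial_sum_le_law k c : (k < n)%N ->
  P [set t | (partial_sum k.+1 t <= c)%R] =
  \int[distribution P (partial_sum k)]_x
    distribution P (a k) [set y | (x + y <= c)%R].
Proof.
move=> kn; rewrite -product_half_plane -partial_sum_pair_law//.
  by congr (P _); apply/seteqP; split=> t; rewrite /= partial_sumS.
apply: measurable_le_set.
by apply: measurable_funD; [exact: measurable_fst|exact: measurable_snd].
Qed.

End independent_sums.

Section sum_domination.
Context {d d' : measure_display} {T : measurableType d} {T' : measurableType d'}
  {R : realType} (P : probability T R) (Q : probability T' R).
Variables (n : nat) (a : nat -> {mfun T >-> R}) (b : nat -> {mfun T' >-> R}).
Local Open Scope ereal_scope.

(** Summands are exchanged one at a time. Integrating over [a k] first replaces the partial sum of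
    the [a i] by that of the [b i]; exchanging the order of integration then allows [a k] to be
    replaced by [b k]. *)
Lemma partial_sum_domination :
  (forall C : nat -> set R, (forall i, measurable (C i)) ->
    P (\bigcap_(i < n) (a i @^-1` C i)) = \prod_(i < n) P (a i @^-1` C i)) ->
  (forall C : nat -> set R, (forall i, measurable (C i)) ->
    Q (\bigcap_(i < n) (b i @^-1` C i)) = \prod_(i < n) Q (b i @^-1` C i)) ->
  (forall i c, (i < n)%N ->
    P [set t | (a i t <= c)%R] <= Q [set t | (b i t <= c)%R]) ->
  forall k c, (k <= n)%N ->
  P [set t | (partial_sum a k t <= c)%R] <= Q [set t | (partial_sum b k t <= c)%R].
Proof.
move=> inda indb ab; elim=> [|k IH] c kn.
  have [c0|c0] := leP 0%R c.
    rewrite (_ : [set t | (partial_sum b 0 t <= c)%R] = setT).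
      rewrite probability_setT probability_le1//.
      by apply: measurable_le_set; exact: measurable_funP.
    by apply/seteqP; split=> // t _ /=; rewrite partial_sum0.
  rewrite (_ : [set t | (partial_sum a 0 t <= c)%R] = set0) ?measure0//.
  by apply/seteqP; split=> // t /=; rewrite partial_sum0 leNgt c0.
rewrite (partial_sum_le_law inda c kn) (partial_sum_le_law indb c kn).
rewrite convolution_cdfC.
apply: (@le_trans _ _ (\int[distribution P (a k)]_y
    distribution Q (partial_sum b k) [set x | (x + y <= c)%R])).
  apply: ge0_le_integral => //.
  - exact: measurable_convolution_cdfC.
  - exact: measurable_convolution_cdfC.
  - move=> y _; have := IH (c - y)%R (ltnW kn).
    by congr (P _ <= Q _); apply/seteqP; split=> t /=; rewrite lerBrDr.
rewrite -convolution_cdfC; apply: ge0_le_integral => //.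
- exact: measurable_convolution_cdf.
- exact: measurable_convolution_cdf.
- move=> x _; have := ab k (c - x)%R kn.
  by congr (P _ <= Q _); apply/seteqP; split=> t /=; rewrite lerBrDl.
Qed.

End sum_domination.

(** * The bound *)

Section laws_of_logarithms.
Context {R : realType}.
Local Notation mu := (@lebesgue_measure R).

Lemma Gamma_ge0 (x : R) : 0 <= Gamma x.
Proof.
by apply: Rintegral_ge0 => // y _; rewrite mulr_ge0 ?powR_ge0 ?expR_ge0.
Qed.

Lemma mGamma_ge0 m (x : R) : 0 <= mGamma m x.
Proof.
by rewrite mulr_ge0 ?powR_ge0// prodr_ge0// => i _; exact: Gamma_ge0.
Qed.

Section chi_squared_law.
Context {d : measure_display} {T : measurableType d} (Q : probability T R).
Variables (Y : {RV Q >-> R}) (al : R).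
Hypothesis Y_chi2 : chi2_distributed Q al Y.

Let Y_law B : measurable B -> Q (Y @^-1` B) = chi2_prob al B.
Proof. exact: Y_chi2.2. Qed.

Let C0 : R := (2 `^ (al / 2) * Gamma (al / 2))^-1.

Let C0_ge0 : 0 <= C0.
Proof. by rewrite invr_ge0 mulr_ge0 ?powR_ge0 ?Gamma_ge0. Qed.

Let chi2_probE (D B : set R) : measurable D -> B `&` `]0, +oo[ = D ->
  (chi2_prob al B = C0%:E * \int[mu]_(x in D) (expR ((al / 2 - 1) * ln x - x / 2))%:E)%E.
Proof.
move=> mD BD; rewrite /chi2_prob BD -ge0_integralZl//.
- apply: eq_integral => x; rewrite inE -BD => -[_ /=]; rewrite in_itv/= andbT => x0.
  rewrite /chi2_pdf /powR gt_eqF// -expRD -EFinM mulrC; congr (_ * expR _)%:E.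
- by apply/measurable_EFinP; apply: measurable_funTS; measurability.
Qed.

Lemma chi2_le0 : Q [set w | (Y w <= 0)%R] = 0%E.
Proof.
have -> : [set w | (Y w <= 0)%R] = Y @^-1` [set y | (y <= 0)%R] by [].
rewrite Y_law; last by apply: measurable_le_set; exact: measurable_id.
rewrite (@chi2_probE set0)// ?integral_set0 ?mule0//.
apply/seteqP; split=> // x [] /=; rewrite in_itv/= andbT => x0.
by rewrite ltNge x0.
Qed.

Lemma chi2_log_cdf k : 0 < k -> exists2 C : R, 0 <= C &
  (C%:E * loggamma_int (al / 2 / k) k (fun=> 1%R) = 1)%E /\
  forall c, (Q [set w | (k * ln (Y w / k) <= c)%R] =
    C%:E * loggamma_int (al / 2 / k) k (fun u => (u <= c)%R%:R))%E.
Proof.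
move=> k0; exists (C0 * expR ((al / 2 - 1) * ln k)).
  by rewrite mulr_ge0// expR_ge0.
have E u : expR ((al / 2 - 1 + 1) / k * u - k / 2 * expR (u / k)) =
    loggamma_ker (al / 2 / k) k u by rewrite subrK.
split=> [|c].
  rewrite -(probability_setT Q) -(preimage_setT Y) Y_law//.
  rewrite (@chi2_probE `]0, +oo[%classic) ?setTI// (gamma_mass_substitution _ k0).
  rewrite EFinM -muleA; congr (_ * (_ * _))%E.
  by apply: eq_integral => u _; rewrite E mul1r.
have -> : [set w | (k * ln (Y w / k) <= c)%R] =
  Y @^-1` [set y | (k * ln (y / k) <= c)%R] by [].
rewrite Y_law; last by apply: measurable_le_set; measurability.
rewrite (@chi2_probE `]0, k * expR (c / k)]%classic)//; last first.
  have key x : 0 < x -> (k * ln (x / k) <= c) = (x <= k * expR (c / k)).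
    move=> x0; rewrite -ler_pdivlMl// -ler_expR lnK ?posrE ?divr_gt0//.
    by rewrite ler_pdivrMr// [k^-1 * c]mulrC [_ * k]mulrC.
  apply/seteqP; split=> x /=; rewrite !in_itv/= ?andbT.
    by move=> [xc x0]; rewrite x0 -key.
  by move=> /andP[x0 xc]; rewrite key.
rewrite (gamma_cdf_substitution _ k0) EFinM -muleA; congr (_ * (_ * _))%E.
by apply: eq_integral => u _; rewrite E.
Qed.

End chi_squared_law.

Section wishart_law.
Context {d : measure_display} {T : measurableType d} (P : probability T R).
Variables (m : nat) (a : R) (X : {RV P >-> 'M[R]_m}).
Hypothesis X_wishart : has_law P X (wishart_prob a).
Hypothesis X_posdef : forall w, posdefmx (X w).

Let X_law B : measurable B -> P (X @^-1` B) = wishart_prob a B.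
Proof. exact: X_wishart. Qed.

Lemma wishart_log_det_cdf (p := a - m.+1%:R / 2) : exists2 C : R, 0 <= C &
  (C%:E * wishart_int m p (fun=> 1%R) = 1)%E /\
  forall c, (P [set w | (ln (\det (X w)) <= c)%R] =
    C%:E * wishart_int m p (fun u => (u <= c)%R%:R))%E.
Proof.
pose C := (2 `^ (m%:R * a) * mGamma m a)^-1.
have C0 : 0 <= C by rewrite invr_ge0 mulr_ge0 ?powR_ge0 ?mGamma_ge0.
(* [D = setT] will give the normalization and [D = ]-oo, c]] the distribution function, with the
   same constant. *)
have E (D : set R) : measurable D ->
    (P [set w | D (ln (\det (X w)))] = C%:E * wishart_int m p (\1_D))%E.
  move=> mD; pose B := [set A : 'M[R]_m | D (ln (\det A))].
  have mB : measurable B.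
    have mln : measurable_fun setT (fun A : 'M[R]_m => ln (\det A)).
      by apply: measurable_fun_ln; apply: measurable_fun_det; exact: measurable_id.
    by have := mln measurableT _ mD; rewrite setTI.
  rewrite -[LHS]/(P (X @^-1` B)) X_law// /wishart_prob integral_mkcond.
  rewrite -lebesgue_seqZl//; last 2 first.
  - by move=> s; rewrite lee_fin wishart_fun_ge0// => u; rewrite indicE.
  - by apply: seq_measurable_wishart; exact: measurable_indic.
  apply: eq_integral => v _; rewrite patchE -[sym_mx_seq m v]/(sym_mx v).
  rewrite /wishart_fun; case: asboolP => [pd|npd]; last first.
    rewrite mul0r mule0; case: ifPn => //; rewrite inE => -[_ /=].
    by move/npd.
  rewrite mul1r indicE; case: ifPn; rewrite ?inE ?notin_setE /=.
    move=> [Bv _]; rewrite mem_set// mulr1 /wishart_pdf /powR.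
    rewrite gt_eqF ?posdef_det_gt0// -expRD -EFinM mulrC.
    by congr (_ * expR _)%:E.
  move=> nB; rewrite memNset ?mulr0 ?mule0// => Dv; exact: nB.
exists C => //; split=> [|c].
  have := E _ measurableT.
  rewrite (_ : [set w | _] = setT); last by apply/seteqP; split.
  rewrite probability_setT => ->; congr (_ * _)%E.
  by apply: eq_integral => v _; rewrite /wishart_fun indicT.
have := E `]-oo, c]%classic (measurable_itv _).
rewrite (_ : [set w | _] = [set w | (ln (\det (X w)) <= c)%R]); last first.
  by apply/seteqP; split=> w /=; rewrite in_itv.
move=> ->; congr (_ * _)%E; apply: eq_integral => v _.
by rewrite /wishart_fun indicE mem_setE in_itv.
Qed.

End wishart_law.

Lemma log_det_domination d (T : measurableType d) (P : probability T R)
    d' (T' : measurableType d') (Q : probability T' R) (m : nat) (a : R)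
    (X : {RV P >-> 'M[R]_m.+1}) (Y : {RV Q >-> R}) (c : R) :
  (forall w, posdefmx (X w)) -> has_law P X (wishart_prob a) ->
  chi2_distributed Q ((2 * a - m.+1%:R - 1) * m.+1%:R) Y ->
  (P [set w | (ln (\det (X w)) <= c)%R] <=
   Q [set w | (m.+1%:R * ln (Y w / m.+1%:R) <= c)%R])%E.
Proof.
move=> X_posdef X_law Y_chi2; have M0 : 0 < m.+1%:R :> R by rewrite ltr0n.
have [C C0 [CE ->]] := wishart_log_det_cdf X_law.
have [C' C'0 [C'E ->]] := chi2_log_cdf Y_chi2 M0.
set p := a - _ in CE *.
(* This is where the degrees of freedom come from: they make the slope of the log-gamma law equal to
   the Wishart exponent [p]. *)
have pE : (2 * a - m.+1%:R - 1) * m.+1%:R / 2 / m.+1%:R = p.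
  by rewrite /p -[m.+2]addn1 natrD; field; rewrite gt_eqF.
rewrite pE in C'E *.
(* Read off the positivity of the degrees of freedom contained in [chi2_distributed]. *)
have p0 : 0 < p.
  by have := Y_chi2.1; rewrite (pmulr_lgt0 _ M0) /p -[m.+2]addn1 natrD; lra.
(* An infinite mass times a nonnegative constant is 0 or [+oo], never the 1 required by the
   normalization. *)
have fin : (loggamma_int p m.+1%:R (fun=> 1%R) < +oo)%E.
  rewrite ltey; apply/eqP => h; move: C'E; rewrite h.
  have [->|C'n0] := eqVneq C' 0; first by rewrite mul0e => -[] /eqP; rewrite eq_sym oner_eq0.
  by rewrite gt0_muley// lte_fin lt_neqAle eq_sym C'n0.
have := wishart_domination c p0 fin.
set W := wishart_int m.+1 p _; set K := loggamma_int p m.+1%:R _ in C'E *.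
set h := loggamma_int p m.+1%:R _; set W1 := wishart_int m.+1 p _ in CE * => WK.
rewrite -[leLHS]mule1 -C'E -[leRHS]mule1 -CE.
have -> : (C%:E * W * (C'%:E * K) = C%:E * C'%:E * (W * K))%E by rewrite muleACA.
have -> : (C'%:E * h * (C%:E * W1) = C%:E * C'%:E * (h * W1))%E.
  by rewrite muleACA [(C'%:E * _)%E]muleC.
by rewrite lee_wpmul2l// mule_ge0// lee_fin.
Qed.

End laws_of_logarithms.

Section walk_measurability.
Context {d : measure_display} {T : measurableType d} {R : realType} {m : nat}.
Variables (n : nat) (x : nat -> T -> 'M[R]_m.+1).
Hypothesis mx : forall i, (i < n)%N -> measurable_fun setT (x i).
Hypothesis x_posdef : forall i, (i < n)%N -> forall w, posdefmx (x i w).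

Let walk j w := posdef_walk (fun i => x i w) j.

Let walk_posdef j w : (j < n)%N -> posdefmx (walk j w).
Proof.
move=> jn; apply: posdef_walk_posdef => i ij; apply: x_posdef.
exact: leq_ltn_trans jn.
Qed.

Let measurable_walk j : (j < n)%N -> measurable_fun setT (walk j).
Proof.
elim: j => [|j IH] jn; first exact: mx.
have jn' := ltnW jn.
have ms : measurable_fun setT (fun w => posdef_sqrt (walk j w)).
  by apply: measurable_posdef_sqrt => [w|]; [exact: walk_posdef|exact: IH].
apply: measurable_fun_mulmx => //; apply: measurable_fun_mulmx => //.
exact: mx.
Qed.

Lemma measurable_max_dist :
  measurable_fun setT (fun w => max_dist (fun i => x i w) n).
Proof.
rewrite /max_dist; elim: (index_enum _) => [|j s IH].
  by under eq_fun do rewrite big_nil; exact: measurable_cst.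
under eq_fun do rewrite big_cons.
apply: measurable_maxr => //; apply: measurable_riem_dist1 => [w|].
  exact: walk_posdef.
exact: measurable_walk.
Qed.

(** A pathwise statement: the distance at time [j] is below the maximum, and log-determinants add up
    along the walk because conjugation by [posdef_sqrt S] multiplies the determinant by that of
    [S]. *)
Lemma max_dist_le_log_det t w j : (j < n)%N ->
  max_dist (fun i => x i w) n <= t ->
  \sum_(i < j.+1) ln (\det (x i w)) <= Num.sqrt m.+1%:R * t.
Proof.
move=> jn Ut.
have -> : \sum_(i < j.+1) ln (\det (x i w)) = ln (\det (walk j w)).
  rewrite det_posdef_walk; last first.
    by move=> i ij; apply: x_posdef; exact: leq_ltn_trans jn.
  elim: j.+1 jn => [|k IH] kn; first by rewrite !big_ord0 ln1.
  have xpos i : (i < k.+1)%N -> 0 < \det (x i w).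
    by move=> ik; apply/posdef_det_gt0/x_posdef; exact: leq_trans kn.
  rewrite !big_ord_recr /= IH ?(ltnW kn)// lnM// posrE ?xpos//.
  by rewrite prodr_gt0// => i _; apply: xpos; rewrite ltnW// ltnS.
apply: le_trans (ln_det_le_riem_dist (walk_posdef w jn)) _.
rewrite ler_wpM2l ?sqrtr_ge0//; apply: le_trans Ut.
rewrite /max_dist (bigD1 (Ordinal jn))//= le_max; apply/orP; left.
exact: lexx.
Qed.

End walk_measurability.

Lemma mutually_independent_comp d (T : measurableType d) (R : realType)
    d' (T' : measurableType d') (P : probability T R) n
    (X : nat -> {mfun T >-> T'}) (f : T' -> R) (a : nat -> {mfun T >-> R}) :
  measurable_fun setT f -> (forall i, a i = f \o X i :> (T -> R)) ->
  mutually_independent P (fun i : 'I_n => X i) ->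
  forall C : nat -> set R, (forall i, measurable (C i)) ->
  P (\bigcap_(i < n) (a i @^-1` C i)) = (\prod_(i < n) P (a i @^-1` C i))%E.
Proof.
move=> mf aE indep C mC.
have mB (i : 'I_n) : measurable (f @^-1` C i).
  by rewrite -[X in measurable X]setTI; apply: mf.
have := indep [set: 'I_n]%SET (fun i : 'I_n => f @^-1` C i) mB.
rewrite (_ : \bigcap_(i in _) _ = \bigcap_(i < n) (a i @^-1` C i)).
  move=> ->; apply: eq_big => [i|i _]; first by rewrite finset.in_setT.
  by rewrite aE.
apply/seteqP; split=> w h i /=.
  by move=> ni; have := h (Ordinal ni) (finset.in_setT _); rewrite aE.
by move=> _; have := h i (ltn_ord i); rewrite aE.
Qed.

(** Dividing the bound [Num.sqrt M * t] by [M] is the origin of the exponent [M^(-1/2) * t], and the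
    [k] terms [ln M] give the factor [M ^+ k]. *)
Lemma sum_ln_le_prod_le (R : realType) (k : nat) (M t : R) (y : nat -> R) :
  0 < M -> (forall i, (i < k)%N -> 0 < y i) ->
  \sum_(i < k) (M * ln (y i / M)) <= Num.sqrt M * t ->
  \prod_(i < k) y i <= M ^+ k * expR (M `^ (- 2^-1) * t).
Proof.
move=> M0 y0.
have p0 j : (j <= k)%N -> 0 < \prod_(i < j) y i.
  move=> jk; rewrite prodr_gt0// => i _; apply: y0.
  exact: leq_trans jk.
have -> : \sum_(i < k) (M * ln (y i / M)) = M * (ln (\prod_(i < k) y i) - ln M *+ k).
  elim: k y0 p0 => [|k IH] y0 p0.
    by rewrite !big_ord0 ln1 mulr0n subr0 mulr0.
  rewrite !big_ord_recr /= IH; last 2 first.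
  - by move=> i ik; apply: y0; exact: ltnW.
  - by move=> j jk; apply: p0; exact: leqW.
  by rewrite ln_div ?posrE ?y0// lnM ?posrE ?y0 ?p0// mulrSr; ring.
rewrite -ler_pdivlMl// lerBlDr => h.
rewrite -[leLHS]lnK ?posrE ?p0//.
have -> : M ^+ k = expR (ln M *+ k) by rewrite -mulr_natl expRM_natl lnK.
rewrite -expRD ler_expR addrC; apply: le_trans h _; rewrite lerD2r.
suff -> : M^-1 * (Num.sqrt M * t) = M `^ (- 2^-1) * t by [].
rewrite mulrA; congr (_ * _).
have sM : Num.sqrt M != 0 by rewrite gt_eqF// sqrtr_gt0.
rewrite powRN powR12_sqrt ?ltW// -{1}[M](sqr_sqrtr (ltW M0)).
by field.
Qed.

Theorem proposition4p5 (R : realType) (m n : nat) (hm : (1 <= m)%N)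
    (hn : (1 <= n)%N) (a : R) (ha : (m%:R - 1) / 2 < a)
    (d : measure_display) (T : measurableType d) (P : probability T R)
    (X : nat -> {RV P >-> 'M[R]_m})
    (X_posdef : forall i, (i < n)%N -> forall w, posdefmx (X i w))
    (X_wishart : forall i, (i < n)%N -> has_law P (X i) (wishart_prob a))
    (X_indep : mutually_independent P (fun i : 'I_n => X i))
    (d' : measure_display) (T' : measurableType d') (Q : probability T' R)
    (Y : nat -> {RV Q >-> R})
    (Y_chi2 : forall i, (i < n)%N ->
       chi2_distributed Q ((2 * a - m%:R - 1) * m%:R) (Y i))
    (Y_indep : mutually_independent Q (fun i : 'I_n => Y i))
    (d'' : measure_display) (T'' : measurableType d'') (Q' : probability T'' R)
    (Z : {RV Q' >-> R})
    (Z_chi2 : chi2_distributed Q' ((2 * a - m%:R - 1) * m%:R) Z)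
    (t : R) (ht : 0 < t) :
  let U w := max_dist (fun i => X i w) n in
  (P [set w | (U w <= t)%R] <=
     \big[Order.min/+oo]_(j < n)
       Q [set w | (\prod_(i < j.+1) Y i w <=
                   m%:R ^+ j.+1 * expR (m%:R `^ (- 2^-1) * t))%R])%E /\
  (P [set w | (U w <= t)%R] <=
     Q' [set w | (Z w <= m%:R * expR (m%:R `^ (- 2^-1) * t))%R])%E.
Proof.
case: m hm ha X X_posdef X_wishart X_indep Y_chi2 Z_chi2 => [//|m] _ ha X.
move=> X_posdef X_wishart X_indep Y_chi2 Z_chi2 U.
pose M : R := m.+1%:R; have M0 : 0 < M by rewrite ltr0n.
have mdet (A : {RV P >-> 'M[R]_m.+1}) :
    measurable_fun setT (fun w => ln (\det (A w))).
  by apply: measurable_fun_ln; apply: measurable_fun_det; exact: measurable_funP.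
have mlog (y : {RV Q >-> R}) : measurable_fun setT (fun w => M * ln (y w / M)).
  apply: measurable_funM => //; apply: measurable_fun_ln.
  by apply: measurable_funM => //; exact: measurable_funP.
pose A i : {mfun T >-> R} := HB.pack (fun w => ln (\det (X i w)))
  (@isMeasurableFun.Build _ _ _ _ _ (mdet (X i))).
pose B i : {mfun T' >-> R} := HB.pack (fun w => M * ln (Y i w / M))
  (@isMeasurableFun.Build _ _ _ _ _ (mlog (Y i))).
have indA := @mutually_independent_comp _ _ _ _ _ P n X
  (fun C => ln (\det C)) A.
have indB := @mutually_independent_comp _ _ _ _ _ Q n Y
  (fun y => M * ln (y / M)) B.
have mU : measurable [set w | (U w <= t)%R].
  by apply: measurable_le_set; exact: measurable_max_dist.
have main j : (j < n)%N -> (P [set w | (U w <= t)%R] <=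
    Q [set w | (\prod_(i < j.+1) Y i w <= M ^+ j.+1 * expR (M `^ (- 2^-1) * t))%R])%E.
  move=> jn.
  (* Where some [Y i] is nonpositive, [ln] takes a default value and the sum of logarithms does not
     control the product. These events are null, since the chi-squared density is integrated over
     the positive half-line only. *)
  pose N i := [set w | (Y i w <= 0)%R].
  pose s := Num.sqrt M * t.
  have AE k w : partial_sum A k w = \sum_(i < k) ln (\det (X i w)).
    by elim: k => [|k IH]; rewrite ?partial_sum0 ?big_ord0// partial_sumS IH big_ord_recr.
  have BE k w : partial_sum B k w = \sum_(i < k) (M * ln (Y i w / M)).
    by elim: k => [|k IH]; rewrite ?partial_sum0 ?big_ord0// partial_sumS IH big_ord_recr.
  have mY (y : {mfun T' >-> R}) c : measurable [set w | (y w <= c)%R].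
    by apply: measurable_le_set; exact: measurable_funP.
  have mprod c : measurable [set w | (\prod_(i < j.+1) Y i w <= c)%R].
    by apply: measurable_le_set; apply: measurable_prod => i _; exact: measurable_funP.
  apply: (@le_trans _ _ (P [set w | (partial_sum A j.+1 w <= s)%R])).
    apply: le_measure; rewrite ?inE//.
      by apply: measurable_le_set; exact: measurable_funP.
    move=> w /= Uw; rewrite AE.
    exact: (max_dist_le_log_det X_posdef jn Uw).
  apply: (@le_trans _ _ (Q [set w | (partial_sum B j.+1 w <= s)%R])).
    apply: (@partial_sum_domination _ _ _ _ _ P Q n A B) => //.
    - apply: indA => //.
      by apply: measurable_fun_ln; apply: measurable_fun_det; exact: measurable_id.
    - by apply: indB => //; measurability.
    - move=> i c ni; apply: log_det_domination (X_wishart _ ni) (Y_chi2 _ ni).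
      exact: X_posdef.
  have mN : measurable (\bigcup_(i < n) N i) by apply: fin_bigcup_measurable => // i _; exact: mY.
  have N0 : Q (\bigcup_(i < n) N i) = 0%E.
    apply: measure_negligible => //; rewrite bigcup_mkcond.
    apply: negligible_bigcup => i; case: ifPn => [|_]; last exact: negligible_set0.
    rewrite inE /= => ni; apply/negligibleP; first exact: mY.
    exact: chi2_le0 (Y_chi2 _ ni).
  apply: (@le_trans _ _ (Q ([set w | (\prod_(i < j.+1) Y i w <=
      M ^+ j.+1 * expR (M `^ (- 2^-1) * t))%R] `|` \bigcup_(i < n) N i))).
    apply: le_measure; rewrite ?inE/=; [exact: (mY (partial_sum B j.+1))| |].
      by apply: measurableU => //; exact: mprod.
    move=> w /= Bw; have [h|h] := pselect ((\bigcup_(i < n) N i) w); first by right.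
    left; apply: (@sum_ln_le_prod_le _ _ M t (fun i => Y i w)) => //; last by rewrite -BE.
    move=> i ij; rewrite ltNge; apply/negP => Yi; apply: h; exists i => //=.
    exact: leq_trans jn.
  apply: (le_trans (measureU2 _ (mprod _) mN)).
  by rewrite [X in (_ + X <= _)%E](_ : _ = 0%E) ?adde0//; exact: N0.
split.
  (* The base value [+oo] satisfies any upper bound, so the minimum inherits the inequality proved
     at each index. *)
  apply: (big_ind (fun z => (P [set w | (U w <= t)%R] <= z)%E)).
  - by rewrite leey.
  - by move=> x y Px Py; rewrite le_min Px Py.
  - by move=> j _; exact: main.
(* The index 0 stands for a single factor; [Y 0] and [Z] live on different probability spaces but
   have the same law. *)
apply: le_trans (main 0%N hn) _.
have -> : [set w | (\prod_(i < 1) Y i w <= M ^+ 1 * expR (M `^ (- 2^-1) * t))%R] =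
    Y 0%N @^-1` [set y | (y <= M * expR (M `^ (- 2^-1) * t))%R].
  by apply/seteqP; split=> w /=; rewrite big_ord1 expr1.
have mI : measurable [set y : R | (y <= M * expR (M `^ (- 2^-1) * t))%R].
  by apply: measurable_le_set; exact: measurable_id.
have := (Y_chi2 _ hn).2 _ mI; have := Z_chi2.2 _ mI.
rewrite /distribution /pushforward => ZE YE.
by rewrite YE -ZE.
Qed.
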